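(* Let $L$ be a countable semilattice with no infinite (strictly) increasing sequence. Then there is a Banach space $X_L$ such that $SP_w(X_L)$ is order isomorphic to $L$; that is, there is a bijection $\Theta: L\to SP_w(X_L)$ such that for all $e_1,e_2\in L$, $e_1\le e_2$ if and only if $\Theta e_1\le \Theta e_2$.
   Context: A semilattice is a partially ordered set in which every pair of elements $x,y$ has a least upper bound, denoted $x\vee y$. Banach spaces are real. Spreading models: let $(x_i)$ be a normalized basic sequence in a Banach space. A normalized basic sequence $(\tilde x_i)$ (in some Banach space) is a spreading model of (generated by) $(x_i)$ if there is a sequence of positive numbers $\varepsilon_n\searrow 0$ such that for all $n\in\mathbb{N}$ and all $(a_i)_{i=1}^n\subseteq[-1,1]$, $$\Bigl|\,\bigl\Vert\sum_{i=1}^n a_i x_{k_i}\bigr\Vert-\bigl\Vert\sum_{i=1}^n a_i\tilde x_i\bigr\Vert\,\Bigr|<\varepsilon_n\quad\text{whenever } n\le k_1<\dots<k_n .$$ (Every normalized basic sequence has a subsequence generating a spreading model.) A spreading model $(\tilde x_i)$ dominates a spreading model $(\tilde y_i)$ if there is $C<\infty$ such that $\Vert\sum a_i\tilde y_i\Vert\le C\Vert\sum a_i\tilde x_i\Vert$ for all finitely supported real sequences $(a_i)$. Two spreading models are equivalent if each dominates the other; $[(\tilde x_i)]$ denotes the equivalence class of $(\tilde x_i)$. $SP_w(X)$ is the set of all equivalence classes $[(\tilde x_i)]$ of spreading models generated by normalized weakly null (basic) sequences in $X$. It is partially ordered by: $[(\tilde x_i)]\le[(\tilde y_i)]$ if $(\tilde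 y_i)$ dominates $(\tilde x_i)$. *)

(* Defs.v *)
From HB Require Import structures.
From mathcomp Require Import all_boot all_order all_algebra.
From mathcomp Require Import all_classical all_reals.
From mathcomp Require Import topology normedtype sequences.
Set Implicit Arguments.
Unset Strict Implicit.
Unset Printing Implicit Defensive.

Import Order.TTheory GRing.Theory Num.Theory.
Import numFieldNormedType.Exports.

Local Open Scope classical_set_scope.
Local Open Scope ring_scope.

Section Sequences.
Context {R : realType}.
Implicit Types X Y : completeNormedModType R.

Definition linear_span {X} (x : nat -> X) : set X :=
  [set v | exists n (a : nat -> R), v = \sum_(i < n) a i *: x i].

(* A basic sequence is a Schauder basis of its closed linear span. *)
Definition basic {X} (x : nat -> X) : Prop :=
  forall v, closure (linear_span x) v ->
    exists! a : nat -> R, series (fun i => a i *: x i) @ \oo --> v.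

Definition normalized {X} (x : nat -> X) : Prop := forall i, `|x i| = 1.

Definition weakly_null {X} (x : nat -> X) : Prop :=
  forall f : {linear X -> R^o}, continuous f -> f (x i) @[i --> \oo] --> (0 : R).

(* Sequences are indexed from 0, so the n of the usual definition (n >= 1
   terms, n <= k_1 < ... < k_n) is n.+1 here, and both eps and the indices k_i
   are shifted by one. *)
Definition generates {X Y} (x : nat -> X) (y : nat -> Y) : Prop :=
  exists eps : nat -> R,
    [/\ forall n, 0 < eps n,
        nonincreasing_seq eps,
        eps @ \oo --> (0 : R) &
        forall (n : nat) (a : 'I_n.+1 -> R) (k : 'I_n.+1 -> nat),
          (forall i, -1 <= a i <= 1) ->
          (n <= k ord0)%N ->
          (forall i j : 'I_n.+1, (i < j)%N -> (k i < k j)%N) ->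
          `| `|\sum_i a i *: x (k i)| - `|\sum_i a i *: y i| | < eps n].

Definition dominates {X Y} (x : nat -> X) (y : nat -> Y) : Prop :=
  exists C : R, forall n (a : nat -> R),
    `|\sum_(i < n) a i *: y i| <= C * `|\sum_(i < n) a i *: x i|.

End Sequences.

(* Spreading models generated in a fixed space live in varying Banach spaces,
   so the ambient space is bundled with the sequence. *)
Record nbseq (R : realType) := NBSeq {
  nbspace : completeNormedModType R;
  nbval :> nat -> nbspace;
  nb_normalized : normalized nbval;
  nb_basic : basic nbval }.

(* [nbseq R] is too large for [set]: the universe of [completeNormedModType R]
   is strictly above that of the argument of [set]. Collections of
   such sequences are therefore plain predicates. *)
Section SpreadingModels.
Context {R : realType}.
Implicit Types x y z : nbseq R.

Definition equivalent x y : Prop := dominates x y /\ dominates y x.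

Definition eq_class x : nbseq R -> Prop := fun y => equivalent x y.

Definition spreading_model_w (X : completeNormedModType R) y : Prop :=
  exists x : nat -> X,
    [/\ normalized x, basic x, weakly_null x & generates x y].

Definition SPw (X : completeNormedModType R) : Type :=
  {A : nbseq R -> Prop | exists2 y, spreading_model_w X y & A = eq_class y}.

Definition SPw_le (X : completeNormedModType R) (A B : SPw X) : Prop :=
  exists x y, [/\ sval A = eq_class x, sval B = eq_class y & dominates y x].

Lemma dominates_refl x : dominates x x.
Proof. by exists 1 => n a; rewrite mul1r. Qed.

Lemma dominates_trans y x z : dominates x y -> dominates y z -> dominates x z.
Proof.
move=> [C xy] [D yz]; exists (Num.max D 0 * C) => n a.
apply: (le_trans (yz n a)); rewrite -mulrA.
apply: (@le_trans _ _ (Num.max D 0 * `|\sum_(i < n) a i *: y i|)).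
  by apply: ler_wpM2r => //; rewrite le_max lexx.
by apply: ler_wpM2l => //; rewrite le_max lexx orbT.
Qed.

Lemma eq_class_equivalent x y : eq_class x = eq_class y <-> equivalent x y.
Proof.
split=> [xy|[xy yx]].
  suff : eq_class x y by [].
  by rewrite xy; split; exact: dominates_refl.
apply: functional_extensionality_dep => z.
apply: propext; split=> -[h1 h2]; split.
- exact: dominates_trans yx h1.
- exact: dominates_trans h2 xy.
- exact: dominates_trans xy h1.
- exact: dominates_trans h2 yx.
Qed.

Lemma SPw_leP (X : completeNormedModType R) (A B : SPw X) x y :
  sval A = eq_class x -> sval B = eq_class y ->
  SPw_le A B <-> dominates y x.
Proof.
move=> Ax By; split=> [[x' [y' []]]|]; last by exists x, y.
rewrite Ax By => /eq_class_equivalent[_ x'x] /eq_class_equivalent[yy' _] h.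
exact: dominates_trans yy' (dominates_trans h x'x).
Qed.

End SpreadingModels.

(* Main.v *)
(* Each element e of L gets an infinite set of scales k, and with it the Lorentz
   space d(w_e, 1) whose norm is the sum over these k of the average of the
   N_k largest moduli of the coordinates; X_L is the l_1-sum of these spaces.
   Sets of scales are chosen monotone in e, the set of a join is contained in
   the union of the two sets, and if e is not below e' then, along some
   initial segments, the set of e has far more elements than that of e'.
   Hence the unit basis of the e' summand dominates that of the e summand
   exactly when e <= e'.

   A gliding hump argument in l_1-sums shows that a weakly null sequence x_n has
   uniformly small tails over (e, k). Let g be maximal such that the unit basis
   of the g summand is dominated by the spreading model y; g exists because L has
   no increasing sequence. If the sup norms of the e-components of x_n do not
   vanish in the limit, y dominates the e basis, hence the one of the join of g
   and e, so e <= g. Conversely, since N_(k+1) >= N_k^2, a sum of m disjoint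
   pieces is governed by the norms of the pieces at the scales N_k > m and by
   their sup norms at the other ones, so y is dominated by the g basis. *)
Require Import Defs.
From HB Require Import structures.
From mathcomp Require Import all_boot all_order all_algebra.
From mathcomp Require Import all_classical all_reals.
From mathcomp Require Import topology normedtype sequences.
From mathcomp Require Import ring lra zify.

Import Order.TTheory GRing.Theory Num.Theory.
Import numFieldNormedType.Exports.

Local Open Scope classical_set_scope.
Local Open Scope ring_scope.

Set Implicit Arguments.
Unset Strict Implicit.
Unset Printing Implicit Defensive.

(** * Lorentz spaces *)

(** Countability of [L] turns its elements into labels. Scales are grouped into consecutive blocks,
    each labelled by an element or by nothing, every label recurring infinitely often; [e] skips the
    blocks whose label lies above [e]. A label above [e] and [e'] is above their join, whence the
    inclusion for joins; a block labelled [e'] is skipped by [e'] but used by [e] unless e <= e'.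
    Blocks grow factorially, so one block outweighs all earlier ones. Scale 0, with N_0 = 1, lies in
    every set, so the norm controls coordinates. Every set is infinite, so the components of a
    vector are null sequences, and far terms of a weakly null sequence have nearly disjoint large
    coordinates. The upper bound must not depend on the number m of pieces, while sup norms are paid
    once per scale N_k < m. But the limiting sup norms sum over e to at most 1, and only elements
    below g contribute, so the cost is at most the number of such scales of g, which the norm of m
    basis vectors of d(w_g, 1) already exceeds. Counting pieces is meaningful only for coefficients
    of constant modulus, hence the detour through sign vectors. *)

(* Squaring at each step makes [scale k] large enough to absorb the sum of
   [scale k.-1] disjoint pieces, see [top_avg_near_disjoint_spread]. *)
Fixpoint scale (k : nat) : nat :=
  if k is k'.+1 then (2 * scale k' ^ 2)%N else 1%N.

Arguments scale : simpl never.

Lemma scale0 : scale 0 = 1%N. Proof. by []. Qed.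

Lemma scaleS k : scale k.+1 = (2 * scale k ^ 2)%N. Proof. by []. Qed.

Lemma scale_gt0 k : (0 < scale k)%N.
Proof. by elim: k => // k IH; rewrite scaleS muln_gt0 expn_gt0 IH. Qed.

Lemma scale_double k : (2 * scale k <= scale k.+1)%N.
Proof. by rewrite scaleS leq_mul2l /= -mulnn leq_pmulr ?scale_gt0. Qed.

Lemma scale_square k : (scale k ^ 2 <= scale k.+1)%N.
Proof. by rewrite scaleS leq_pmull. Qed.

Lemma scale_dvd k : (scale k %| scale k.+1)%N.
Proof. by rewrite scaleS dvdn_mull // dvdn_exp. Qed.

Lemma scale_le j k : (j <= k)%N -> (scale j <= scale k)%N.
Proof.
move=> /subnK <-; elim: (k - j)%N => // m IH; rewrite addSn.
by apply: (leq_trans IH); apply: leq_trans (scale_double _); rewrite leq_pmull.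
Qed.

(** Shorter lists are allowed because averages always divide by [scale k]: they do not change the
    supremum, and the empty list keeps the set of averages nonempty. *)
Definition selection (k : nat) (s : seq nat) : bool :=
  uniq s && (size s <= scale k)%N.

Lemma selection_nil k : selection k [::]. Proof. by []. Qed.

Section Average.
Context {R : realType}.
Implicit Types (f g : nat -> R) (k : nat) (s : seq nat).

Definition sel_avg k s f : R := (scale k)%:R^-1 * \sum_(t <- s) `|f t|.

Definition top_avg k f : R := sup [set sel_avg k s f | s in selection k].

Lemma scaleR_gt0 k : (0 : R) < (scale k)%:R.
Proof. by rewrite ltr0n scale_gt0. Qed.

Lemma sel_avg_ge0 k s f : 0 <= sel_avg k s f.
Proof. by rewrite mulr_ge0 ?invr_ge0 ?ler0n ?sumr_ge0. Qed.

Lemma sel_avgD k s f g : sel_avg k s (f \+ g) <= sel_avg k s f + sel_avg k s g.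
Proof.
rewrite -mulrDr ler_wpM2l ?invr_ge0 ?ler0n// -big_split /=.
by apply: ler_sum => t _; exact: ler_normD.
Qed.

Lemma sel_avgZ k s c f : sel_avg k s (fun t => c * f t) = `|c| * sel_avg k s f.
Proof.
rewrite /sel_avg mulrCA; congr (_ * _); rewrite mulr_sumr.
by apply: eq_bigr => t _; rewrite normrM.
Qed.

Lemma sel_avg_bound k s f (M : R) : selection k s ->
  (forall t, `|f t| <= M) -> sel_avg k s f <= M.
Proof.
move=> /andP[_ sk] fM; rewrite /sel_avg ler_pdivrMl ?scaleR_gt0//.
apply: (@le_trans _ _ (\sum_(t <- s) M)); first by apply: ler_sum.
rewrite big_const_seq count_predT iter_addr_0 -[leLHS]mulr_natl.
by rewrite ler_wpM2r ?ler_nat// (le_trans _ (fM 0%N)).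
Qed.

Lemma top_avg_le k f (M : R) :
  (forall s, selection k s -> sel_avg k s f <= M) -> top_avg k f <= M.
Proof.
move=> h; apply: ge_sup; first by exists (sel_avg k [::] f), [::].
by move=> _ [s sk <-]; exact: h.
Qed.

Lemma top_avg_has_sup k f (M : R) : (forall t, `|f t| <= M) ->
  has_sup [set sel_avg k s f | s in selection k].
Proof.
move=> fM; split; first by exists (sel_avg k [::] f), [::].
by exists M => _ [s sk <-]; exact: sel_avg_bound.
Qed.

Lemma sel_avg_le_top k s f (M : R) : (forall t, `|f t| <= M) ->
  selection k s -> sel_avg k s f <= top_avg k f.
Proof.
move=> fM sk; apply: ub_le_sup; last by exists s.
by case: (@top_avg_has_sup k f M fM).
Qed.

Lemma top_avg_ge0 k f (M : R) : (forall t, `|f t| <= M) -> 0 <= top_avg k f.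
Proof.
move=> fM; apply: le_trans (sel_avg_ge0 k [::] f) _.
exact: sel_avg_le_top fM (selection_nil k).
Qed.

(** Exchanges a finite sum with suprema: [F] has no duplicates, so the selection at one entry can be
    changed without affecting the others. *)
Lemma sum_top_avg_le (T : eqType) (F : seq T) (kk : T -> nat)
    (h : T -> nat -> R) (M : R) : uniq F ->
  (forall s : T -> seq nat, (forall p, selection (kk p) (s p)) ->
     \sum_(p <- F) sel_avg (kk p) (s p) (h p) <= M) ->
  \sum_(p <- F) top_avg (kk p) (h p) <= M.
Proof.
elim: F M => [|p F IH] M /=.
  by move=> _ /(_ (fun=> [::]) (fun=> isT)); rewrite !big_nil.
move=> /andP[pF uF] H; rewrite big_cons -lerBrDr.
apply: top_avg_le => sp hsp; rewrite lerBrDr addrC -lerBrDr.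
apply: IH => // s hs; rewrite lerBrDr addrC.
pose s' q := if q == p then sp else s q.
have s'p : s' p = sp by rewrite /s' eqxx.
have adm q : selection (kk q) (s' q) by rewrite /s'; case: eqP => [->|].
have := H s' adm; rewrite big_cons s'p; apply: le_trans.
rewrite lerD2l le_eqVlt; apply/orP; left; apply/eqP.
apply: eq_big_seq => q qF; rewrite /s'; case: eqP => // qp.
by rewrite qp (negbTE pF) in qF.
Qed.

End Average.

(* [lorentz gam] is the l_1-sum over [e : L] of the Lorentz spaces with norm
   [\sum_(k | gam e k) top_avg k], that is d(w_e, 1) for the weight
   [w_e i = \sum_(k | gam e k && (i < scale k)) 1 / scale k]. *)
Record profile (L : Type) := Profile {
  scales :> L -> nat -> bool;
  scales0 : forall e, scales e 0%N;
  scales_unbounded : forall e K, exists2 k, (K <= k)%N & scales e k }.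

Section LorentzSpace.
Context {R : realType} {L : choiceType} (gam : profile L).
Implicit Types (x y : L * nat -> R^o) (F : seq (L * nat)).

Definition active F : bool := uniq F && all (fun p => gam p.1 p.2) F.

Definition selections (s : L * nat -> seq nat) : Prop :=
  forall p, selection p.2 (s p).

Definition slice x (e : L) : nat -> R := fun t => x (e, t).

(** The norm is one supremum of finite sums of moduli instead of an infinite sum of suprema: such
    sums pass to pointwise limits, on which completeness rests. *)
Definition ev F (s : L * nat -> seq nat) x : R :=
  \sum_(p <- F) sel_avg p.2 (s p) (slice x p.1).

Definition evs x : set R := [set r | exists F s,
  [/\ active F, selections s & r = ev F s x]].

Definition finite_norm : {pred (L * nat -> R^o)} :=
  fun x => `[< exists M : R, forall r, evs x r -> r <= M >].

Lemma evD F s x y : ev F s (x + y) <= ev F s x + ev F s y.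
Proof. by rewrite -big_split /=; apply: ler_sum => p _; exact: sel_avgD. Qed.

Lemma evZ F s (c : R) x : ev F s (c *: x) = `|c| * ev F s x.
Proof. by rewrite mulr_sumr; apply: eq_bigr => p _; rewrite -sel_avgZ. Qed.

Lemma evs0 x : evs x 0.
Proof.
by exists [::], (fun=> [::]); split => //; rewrite /ev big_nil.
Qed.

Lemma evs_coord x e t : evs x `|x (e, t)|.
Proof.
exists [:: (e, 0%N)], (fun p => if p == (e, 0%N) then [:: t] else [::]).
split.
- by rewrite /active /= scales0.
- by move=> p; case: eqP => // ->.
- by rewrite /ev big_seq1 /= eqxx /sel_avg big_seq1 scale0 invr1 mul1r.
Qed.

Lemma finite_norm_submod : submod_closed finite_norm.
Proof.
split.
  apply/asboolP; exists 0 => _ [F [s [_ _ ->]]].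
  by rewrite /ev big1 // => p _; rewrite /sel_avg big1 ?mulr0// => t _; rewrite normr0.
move=> c x y /asboolP[M xM] /asboolP[M' yM]; apply/asboolP; exists (`|c| * M + M').
move=> _ [F [s [aF as_ ->]]]; apply: le_trans (evD _ _ _ _) _.
apply: lerD; last by apply: yM; exists F, s.
by rewrite evZ ler_wpM2l//; apply: xM; exists F, s.
Qed.

HB.instance Definition _ := GRing.isSubmodClosed.Build R (L * nat -> R^o)
  finite_norm finite_norm_submod.

Record lorentz := Lorentz {
  lorentz_val :> L * nat -> R^o;
  lorentz_valP : lorentz_val \in finite_norm }.

HB.instance Definition _ := [isSub for lorentz_val].
HB.instance Definition _ := [Choice of lorentz by <:].
HB.instance Definition _ := [SubChoice_isSubLmodule of lorentz by <:].

Implicit Types v w : lorentz.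

Definition lorentz_norm v : R := sup (evs v).

Lemma evs_has_sup v : has_sup (evs v).
Proof.
split; first by exists 0; exact: evs0.
by have /asboolP[M h] := lorentz_valP v; exists M => r /h.
Qed.

Lemma evs_le_norm v r : evs v r -> r <= lorentz_norm v.
Proof. by apply: ub_le_sup; case: (evs_has_sup v). Qed.

Lemma ev_le_norm F s v : active F -> selections s -> ev F s v <= lorentz_norm v.
Proof. by move=> aF as_; apply: evs_le_norm; exists F, s. Qed.

Lemma norm_le_ev v M : (forall F s, active F -> selections s -> ev F s v <= M) ->
  lorentz_norm v <= M.
Proof.
move=> h; apply: ge_sup; first by case: (evs_has_sup v).
by move=> _ [F [s [aF as_ ->]]]; exact: h.
Qed.

Lemma lorentz_normD v w : lorentz_norm (v + w) <= lorentz_norm v + lorentz_norm w.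
Proof.
apply: norm_le_ev => F s aF as_; apply: le_trans (evD _ _ _ _) _.
by apply: lerD; exact: ev_le_norm.
Qed.

Lemma lorentz_normZ_le c v : lorentz_norm (c *: v) <= `|c| * lorentz_norm v.
Proof.
by apply: norm_le_ev => F s aF as_; rewrite evZ ler_wpM2l// ev_le_norm.
Qed.

Lemma lorentz_normZ c v : lorentz_norm (c *: v) = `|c| * lorentz_norm v.
Proof.
apply/eqP; rewrite eq_le lorentz_normZ_le /=.
have [->|c0] := eqVneq c 0.
  by rewrite normr0 mul0r evs_le_norm//; exact: evs0.
rewrite -ler_pdivlMl ?normr_gt0// -normfV.
by apply: le_trans (lorentz_normZ_le _ _); rewrite scalerA mulVf// scale1r.
Qed.

Lemma lorentz_norm_eq0 v : lorentz_norm v = 0 -> v = 0.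
Proof.
move=> v0; apply: val_inj; apply/funext => -[e t] /=.
by apply/eqP; rewrite -normr_le0 -[leRHS]v0; exact: evs_le_norm (evs_coord _ _ _).
Qed.

HB.instance Definition _ := Lmodule_isNormed.Build R lorentz
  lorentz_normD lorentz_normZ lorentz_norm_eq0.

Lemma coord_le_norm v p : `|v p| <= `|v|.
Proof. by case: p => e t; exact: evs_le_norm (evs_coord _ _ _). Qed.

Lemma ev_cvg {T : Type} (G : set_system T) {FG : Filter G} F s
    (u : T -> L * nat -> R^o) x :
  (forall p, u i p @[i --> G] --> x p) ->
  ev F s (u i) @[i --> G] --> ev F s x.
Proof.
move=> ux; apply: cvg_big => [|p _]; first exact: add_continuous.
apply: cvgM; first exact: cvg_cst.
apply: cvg_big => [|t _]; first exact: add_continuous.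
by apply: cvg_norm; exact: ux.
Qed.

Lemma lorentz_complete (F : set_system lorentz) :
  ProperFilter F -> cauchy F -> cvg F.
Proof.
move=> FF Fc.
have Fex : cauchy_ex F by apply/cauchyP.
have Fv (p : L * nat) : cvg ((v : lorentz) p @[v --> F]).
  apply: R_complete; apply/cauchyP => eps eps0.
  have [w Fw] := Fex eps eps0; exists (w p).
  rewrite /nbhs /=; apply: filterS Fw => v.
  rewrite -!ball_normE /= => wv.
  by apply: le_lt_trans wv; exact: (coord_le_norm (w - v) p).
pose x p : R^o := lim ((v : lorentz) p @[v --> F]).
(* Fatou argument: with [G] and [s] fixed, the bound on [ev G s (u - v)] survives the pointwise
   limit in [u], uniformly in [G] and [s]. *)
have close (eps : R) : 0 < eps -> exists w : lorentz, F (ball w eps) /\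
    forall v, ball w eps v -> forall G s, active G -> selections s ->
    ev G s (x - v :> (L * nat -> R^o)) <= eps + eps.
  move=> eps0; have [w Fw] := Fex eps eps0; exists w; split=> // v wv G s aG as_.
  have lim_ev : ev G s ((u : lorentz) \- v) @[u --> F] --> ev G s (x - v).
    apply: ev_cvg => p; apply: cvgB; last exact: cvg_cst.
    exact: Fv.
  apply: (cvgr_to_le lim_ev); apply: filterS Fw => u wu /=.
  rewrite -[leLHS]/(ev G s (lorentz_val (u - v))).
  apply: (@le_trans _ _ `|u - v|); first exact: ev_le_norm.
  have -> : u - v = (u - w) + (w - v) by rewrite addrA subrK.
  apply: le_trans (ler_normD (u - w) (w - v)) _; apply: lerD; apply: ltW.
    by move: wu; rewrite -ball_normE /= distrC.
  by move: wv; rewrite -ball_normE.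
have xP : x \in finite_norm.
  have [w [_ /(_ w) hw]] := close 1 ltr01.
  apply/asboolP; exists (1 + 1 + `|w|) => _ [G [s [aG as_ ->]]].
  rewrite -[x](subrK (w : L * nat -> R^o)).
  apply: le_trans (evD _ _ _ _) _.
  by apply: lerD; [apply: hw => //; exact: ballxx|exact: ev_le_norm].
apply/cvg_ex; exists (Lorentz xP); apply/cvgrPdist_le => eps eps0.
have [w [Fw hw]] := close (eps / 2) (divr_gt0 eps0 (ltr0Sn _ 1)).
apply: filterS Fw => v wv; apply: norm_le_ev => G s aG as_.
by rewrite [leRHS]splitr; exact: hw.
Qed.

HB.instance Definition _ := Uniform_isComplete.Build lorentz lorentz_complete.
End LorentzSpace.

Lemma sum_uniq_le {R : realType} {T : eqType} (F G : seq T) (c : T -> R) :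
  uniq F -> uniq G -> {subset F <= G} -> (forall p, 0 <= c p) ->
  \sum_(p <- F) c p <= \sum_(p <- G) c p.
Proof.
move=> uF uG FG c0.
have FE : perm_eq F [seq p <- G | p \in F].
  apply: uniq_perm => //; first exact: filter_uniq.
  move=> p; rewrite mem_filter; case pF: (p \in F) => //=.
  by rewrite FG.
rewrite (perm_big _ FE) /= big_filter [leRHS](bigID (mem F)) /= lerDl.
by apply: sumr_ge0 => p _; exact: c0.
Qed.

Lemma unbounded_uniq_seq (P : nat -> Prop) :
  (forall K, exists2 k, (K <= k)%N & P k) ->
  forall n, exists s : seq nat, [/\ uniq s, size s = n & forall k, k \in s -> P k].
Proof.
move=> h; elim=> [|n [s [us sn sP]]]; first by exists [::].
have [k sk Pk] := h (\max_(i <- s) i).+1; exists (k :: s); split => /=.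
- rewrite us andbT; apply/negP => ks.
  by have := @leq_bigmax_seq _ s xpredT id k ks isT; rewrite leqNgt sk.
- by rewrite sn.
- by move=> j; rewrite inE => /predU1P[->//|/sP].
Qed.

(** * Comparison of averages *)

Section AverageBounds.
Context {R : realType}.
Implicit Types (f g : nat -> R) (k : nat) (s : seq nat).

Lemma top_avgD k f g (M M' : R) :
  (forall t, `|f t| <= M) -> (forall t, `|g t| <= M') ->
  top_avg k (f \+ g) <= top_avg k f + top_avg k g.
Proof.
move=> fM gM; apply: top_avg_le => s sk; apply: le_trans (sel_avgD _ _ _ _) _.
by apply: lerD; [exact: sel_avg_le_top fM sk|exact: sel_avg_le_top gM sk].
Qed.

Lemma top_avg_inj_err k f g (M c : R) (h : nat -> nat) : 0 <= c ->
  (forall t, `|g t| <= M) ->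
  (forall t, f t != 0 -> `|f t| <= `|g (h t)| + c) ->
  (forall t t', f t != 0 -> f t' != 0 -> h t = h t' -> t = t') ->
  top_avg k f <= top_avg k g + c.
Proof.
move=> c0 gM fg hI; apply: top_avg_le => s /andP[us sk].
pose r := [seq t <- s | f t != 0].
have rs : (size r <= scale k)%N.
  by rewrite size_filter; apply: leq_trans (count_size _ _) sk.
have rk : selection k (map h r).
  apply/andP; split; last by rewrite size_map.
  rewrite map_inj_in_uniq ?filter_uniq// => t t'.
  by rewrite !mem_filter => /andP[ft _] /andP[ft' _]; exact: hI.
apply: (le_trans _ (lerD (sel_avg_le_top gM rk) (lexx c))).
rewrite /sel_avg big_map ler_pdivrMl ?scaleR_gt0// mulrDr mulrA mulfV ?mul1r; last first.
  by rewrite gt_eqF// scaleR_gt0.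
rewrite (bigID (fun t => f t != 0)) /= [X in _ + X]big1 ?addr0; last first.
  by move=> t /negPn/eqP->; rewrite normr0.
rewrite -big_filter -/r.
apply: (@le_trans _ _ (\sum_(t <- r) (`|g (h t)| + c))).
  by rewrite big_seq [leRHS]big_seq; apply: ler_sum => t; rewrite mem_filter => /andP[/fg].
rewrite big_split /= lerD2l big_const_seq count_predT iter_addr_0.
by rewrite -[leLHS]mulr_natl ler_wpM2r// ler_nat.
Qed.

Lemma top_avg_inj k f g (M : R) (h : nat -> nat) :
  (forall t, `|g t| <= M) ->
  (forall t, f t != 0 -> `|f t| <= `|g (h t)|) ->
  (forall t t', f t != 0 -> f t' != 0 -> h t = h t' -> t = t') ->
  top_avg k f <= top_avg k g.
Proof.
move=> gM fg hI; rewrite -[leRHS]addr0.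
by apply: (@top_avg_inj_err k f g M 0 h) => // t ft; rewrite addr0 fg.
Qed.

Lemma top_avg_mono k f g (M : R) : (forall t, `|g t| <= M) ->
  (forall t, `|f t| <= `|g t|) -> top_avg k f <= top_avg k g.
Proof. by move=> gM fg; apply: (@top_avg_inj k f g M id). Qed.

Lemma top_avg_bound k f (M : R) : (forall t, `|f t| <= M) -> top_avg k f <= M.
Proof. by move=> fM; apply: top_avg_le => s sk; exact: sel_avg_bound. Qed.

Lemma coord_le_top0 f t (M : R) : (forall t, `|f t| <= M) ->
  `|f t| <= top_avg 0 f.
Proof.
move=> fM; have := @sel_avg_le_top _ 0 [:: t] f M fM isT.
by rewrite /sel_avg big_seq1 scale0 invr1 mul1r.
Qed.

(** Cut [s] into [c] pieces of length at most [scale k]; each piece is a selection. *)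
Lemma sum_le_top_avg k c s f (M : R) : (forall t, `|f t| <= M) ->
  uniq s -> (size s <= c * scale k)%N ->
  \sum_(t <- s) `|f t| <= c%:R * (scale k)%:R * top_avg k f.
Proof.
move=> fM; elim: c s => [|c IH] s us.
  by rewrite mul0n leqn0 size_eq0 => /eqP->; rewrite big_nil !mul0r.
move=> ss; rewrite -(cat_take_drop (scale k) s) big_cat /=.
rewrite mulrS -mulrA mulrDl mul1r mulrA.
apply: lerD; last first.
  by apply: IH; [exact: drop_uniq|rewrite size_drop leq_subLR -mulSn].
rewrite -ler_pdivrMl ?scaleR_gt0//; apply: sel_avg_le_top fM _.
by rewrite /selection take_uniq// size_take_min geq_minl.
Qed.

(** Since [scale k] divides [scale k.+1], a longer selection is cut into pieces of the smaller scale
    without rounding loss. *)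
Lemma top_avg_decr k f (M : R) : (forall t, `|f t| <= M) ->
  top_avg k.+1 f <= top_avg k f.
Proof.
move=> fM; apply: top_avg_le => s /andP[us sk].
have /dvdnP[c cE] := scale_dvd k.
rewrite /sel_avg ler_pdivrMl ?scaleR_gt0// {1}cE natrM.
by apply: sum_le_top_avg fM us _; rewrite -cE.
Qed.

Lemma top_avg_ge_all k f (M d : R) : (forall t, `|f t| <= M) ->
  (forall K, exists2 t, (K <= t)%N & d <= `|f t|) -> d <= top_avg k f.
Proof.
move=> fM /unbounded_uniq_seq/(_ (scale k))[s [us sk sd]].
have sel : selection k s by rewrite /selection us sk /=.
apply: (le_trans _ (sel_avg_le_top fM sel)).
rewrite /sel_avg ler_pdivlMl ?scaleR_gt0// -sk.
rewrite -[leLHS](_ : \sum_(t <- s) d = _).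
  by rewrite big_seq [leRHS]big_seq; apply: ler_sum => t /sd.
by rewrite big_const_seq count_predT iter_addr_0 mulr_natl.
Qed.

(** Scales at least double, so the sum is dominated by a geometric one. *)
Lemma sum_scale_inv j K :
  \sum_(0 <= k < K) (scale (j + k))%:R^-1 <= 2 / (scale j)%:R :> R.
Proof.
elim: K j => [|K IH] j; first by rewrite big_geq// divr_ge0.
rewrite big_nat_recl// addn0.
under eq_bigr do rewrite addnS -addSn.
have := IH j.+1 => /(lerD (lexx ((scale j)%:R^-1 : R)))/le_trans; apply.
have h : 2 / (scale j.+1)%:R <= (scale j)%:R^-1 :> R.
  rewrite ler_pdivrMr ?scaleR_gt0// -ler_pdivrMl ?invr_gt0 ?scaleR_gt0//.
  by rewrite invrK mulrC -natrM ler_nat scale_double.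
apply: le_trans (lerD (lexx _) h) _.
by rewrite -mulr2n mulr_natl.
Qed.

End AverageBounds.

(** * Norm estimates in the Lorentz sum *)

Section SpaceBounds.
Context {R : realType} {L : choiceType} {gam : profile L}.
Implicit Types (v w : @lorentz R L gam) (F : seq (L * nat)) (e : L) (a : nat -> R).

Lemma slice_bound v e t : `|slice v e t| <= `|v|.
Proof. exact: coord_le_norm. Qed.

Lemma sum_top_le_norm F v : active gam F ->
  \sum_(p <- F) top_avg p.2 (slice v p.1) <= `|v|.
Proof.
move=> aF; apply: sum_top_avg_le; first by case/andP: aF.
by move=> s hs; exact: ev_le_norm.
Qed.

Lemma norm_le_sum_top v M :
  (forall F, active gam F -> \sum_(p <- F) top_avg p.2 (slice v p.1) <= M) ->
  `|v| <= M.
Proof.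
move=> h; apply: norm_le_ev => F s aF hs; apply: (le_trans _ (h F aF)).
by apply: ler_sum => p _; apply: sel_avg_le_top (slice_bound v p.1) (hs p).
Qed.

Definition level_sum e K a : R := \sum_(0 <= k < K | gam e k) top_avg k a.

Lemma level_seq_active e K :
  active gam [seq (e, k) | k <- [seq k <- index_iota 0 K | gam e k]].
Proof.
apply/andP; split.
  by rewrite map_inj_uniq ?filter_uniq ?iota_uniq// => i j [].
by apply/allP => p /mapP[k]; rewrite mem_filter => /andP[gk _] ->.
Qed.

Lemma level_sum_le_norm e K v : level_sum e K (slice v e) <= `|v|.
Proof.
apply: (le_trans _ (sum_top_le_norm v (level_seq_active e K))).
by rewrite big_map big_filter.
Qed.

Lemma sub_level_seq e F : uniq F ->
  all (fun p => (p.1 == e) && gam p.1 p.2) F ->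
  {subset F <= [seq (e, k) | k <- [seq k <- index_iota 0 (\max_(p <- F) p.2).+1 | gam e k]]}.
Proof.
move=> uF /allP h [e' k] pF; have /andP[/eqP e'E gk] := h _ pF.
rewrite (_ : e' = e)// in gk pF *.
apply/mapP; exists k; last by [].
rewrite mem_filter gk mem_index_iota /= ltnS.
exact: (@leq_bigmax_seq _ F xpredT (fun p : L * nat => p.2) (e, k)).
Qed.

Lemma norm_le_level_sum e v M :
  (forall p, p.1 != e -> v p = 0) ->
  (forall K, level_sum e K (slice v e) <= M) -> `|v| <= M.
Proof.
move=> v0 h; apply: norm_le_sum_top => F /andP[uF aF].
rewrite (bigID (fun p => p.1 == e)) /= [X in _ + X]big1 ?addr0; last first.
  move=> p pe; apply/eqP; rewrite eq_le; apply/andP; split.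
    by apply: top_avg_bound => t; rewrite /slice v0// normr0.
  exact: top_avg_ge0 (slice_bound v p.1).
rewrite -big_filter; set G := [seq _ <- _ | _].
apply: (le_trans _ (h (\max_(p <- G) p.2).+1)).
have aG : all (fun p => (p.1 == e) && gam p.1 p.2) G.
  apply/allP => p; rewrite mem_filter => /andP[-> pF] /=.
  by move/allP: aF; apply.
apply: (@le_trans _ _ (\sum_(p <- [seq (e, k) | k <- [seq k <-
    index_iota 0 (\max_(p <- G) p.2).+1 | gam e k]]) top_avg p.2 (slice v p.1))).
  apply: sum_uniq_le; [exact: filter_uniq| |exact: sub_level_seq (filter_uniq _ uF) aG|].
    by case/andP: (level_seq_active e (\max_(p <- G) p.2).+1).
  by move=> p; exact: top_avg_ge0 (slice_bound v p.1).
by rewrite big_map big_filter.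
Qed.

(** Otherwise the averages of the [e]-component at all scales would be at least [d], and infinitely
    many scales of [e] would make the norm infinite. This is the purpose of [scales_unbounded]. *)
Lemma coord_small v e (d : R) : 0 < d ->
  exists T, forall t, (T <= t)%N -> `|v (e, t)| < d.
Proof.
move=> d0; apply: contrapT => /forallNP h.
have big k : d <= top_avg k (slice v e).
  apply: top_avg_ge_all (slice_bound v e) _ => K.
  have /existsNP[t /not_implyP[Kt /negP]] := h K.
  by rewrite -leNgt => dt; exists t.
pose n := (Num.truncn (`|v| / d)).+1.
have [s [us sn sg]] := unbounded_uniq_seq (@scales_unbounded _ gam e) n.
have aF : active gam [seq (e, k) | k <- s].
  rewrite /active map_inj_uniq ?us; last by move=> i j [].
  by apply/allP => p /mapP[k /sg gk ->].
have := sum_top_le_norm v aF; rewrite big_map /= => h1.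
have : d *+ n <= `|v|.
  apply: (le_trans _ h1); rewrite -sn -[leLHS](_ : \sum_(k <- s) d = _).
    by apply: ler_sum.
  by rewrite big_const_seq count_predT iter_addr_0.
rewrite -mulr_natr -ler_pdivlMl// mulrC leNgt => /negP; apply.
by rewrite /n; exact: truncnS_gt.
Qed.

Definition delta_fun (q : L * nat) : L * nat -> R^o := fun p => (p == q)%:R.

Lemma delta_fun_finite q : delta_fun q \in finite_norm gam.
Proof.
(* With a single nonzero coordinate, the average at scale [k] is at most [1 / scale k], and these
   numbers sum to at most 2. *)
apply/asboolP; exists 2; move=> _ [F [s [/andP[uF _] hs ->]]].
pose c (p : L * nat) : R := (p.1 == q.1)%:R * (scale p.2)%:R^-1.
have c0 p : 0 <= c p by rewrite mulr_ge0 ?invr_ge0 ?ler0n.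
apply: (@le_trans _ _ (\sum_(p <- F) c p)).
  apply: ler_sum => p _; rewrite /sel_avg mulrC ler_wpM2r ?invr_ge0 ?ler0n//.
  have [pq|pq] := eqVneq p.1 q.1; last first.
    rewrite big1 // => t _; rewrite /slice /delta_fun.
    by case: eqP => [E|]; rewrite ?normr0//; rewrite -E eqxx in pq.
  have /andP[us _] := hs p.
  have -> : \sum_(t <- s p) `|slice (delta_fun q) p.1 t| = (count_mem q.2 (s p))%:R.
    rewrite -sum1_count natr_sum [RHS]big_mkcond /=.
    apply: eq_bigr => t _; rewrite /slice /delta_fun {1}(surjective_pairing q).
    by rewrite xpair_eqE pq eqxx /=; case: eqP => _; rewrite ?normr1 ?normr0.
  by rewrite (count_uniq_mem _ us) ler_nat leq_b1.
rewrite (bigID (fun p => p.1 == q.1)) /= [X in _ + X]big1 ?addr0; last first.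
  by move=> p /negbTE pq; rewrite /c pq mul0r.
rewrite -big_filter; set G := [seq _ <- _ | _].
pose n := (\max_(p <- G) p.2).+1.
apply: (@le_trans _ _ (\sum_(p <- [seq (q.1, k) | k <- index_iota 0 n]) c p)).
  apply: sum_uniq_le => //; first exact: filter_uniq.
    by rewrite map_inj_uniq ?iota_uniq// => i j [].
  move=> p pG; have := pG; rewrite mem_filter => /andP[/eqP p1 _].
  apply/mapP; exists p.2; last by rewrite -p1; case: p {pG p1}.
  rewrite mem_index_iota /= ltnS.
  exact: (@leq_bigmax_seq _ G xpredT (fun p : L * nat => p.2) p).
rewrite big_map; under eq_bigr do rewrite /c eqxx mul1r /=.
by have := @sum_scale_inv R 0 n; rewrite scale0 divr1.
Qed.

Definition delta q : @lorentz R L gam := Lorentz (delta_fun_finite q).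

Lemma deltaE q p : delta q p = (p == q)%:R. Proof. by []. Qed.

Lemma lorentz_sumE (I : Type) (r : seq I) (P : pred I) (u : I -> @lorentz R L gam) p :
  (\sum_(i <- r | P i) u i) p = \sum_(i <- r | P i) u i p.
Proof. by elim/big_rec2: _ => // i y x _ <-. Qed.

End SpaceBounds.

Arguments level_sum {R L} gam e K a.

(** * Unit bases *)

Section Basis.
Context {R : realType} {L : choiceType} {gam : profile L}.
Implicit Types (v w : @lorentz R L gam) (e : L) (a : nat -> R).

Definition cutoff n a : nat -> R := fun i => if (i < n)%N then a i else 0.

Lemma cutoff_bound n a t : `|cutoff n a t| <= \sum_(i < n) `|a i|.
Proof.
rewrite /cutoff; case: ifP => tn; last by rewrite normr0 sumr_ge0.
by rewrite (bigD1 (Ordinal tn)) //= lerDl sumr_ge0.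
Qed.

Definition comb e n a (h : nat -> nat) : @lorentz R L gam :=
  \sum_(i < n) a i *: delta (e, h i).

Lemma comb_off e n a h p : p.1 != e -> comb e n a h p = 0.
Proof.
move=> pe; rewrite /comb lorentz_sumE big1// => i _.
rewrite -[LHS]/(a i * (p == (e, h i))%:R); case: eqP => [E|]; last by rewrite mulr0.
by rewrite E eqxx in pe.
Qed.

Lemma combE e n a h t :
  slice (comb e n a h) e t = \sum_(i < n) a i * (t == h i)%:R.
Proof.
rewrite /slice /comb lorentz_sumE; apply: eq_bigr => i _.
by rewrite -[LHS]/(a i * ((e, t) == (e, h i))%:R) xpair_eqE eqxx.
Qed.

Lemma comb_at e n a h j :
  {in [pred i | (i < n)%N] &, injective h} -> (j < n)%N ->
  slice (comb e n a h) e (h j) = a j.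
Proof.
move=> hI jn; rewrite combE (bigD1 (Ordinal jn)) //= eqxx mulr1 big1 ?addr0//.
move=> i ij; case: eqP => [E|]; last by rewrite mulr0.
by case/eqP: ij; apply: val_inj => /=; apply: hI => //; exact: ltn_ord.
Qed.

Lemma comb_out e n a h t : (forall i, (i < n)%N -> t != h i) ->
  slice (comb e n a h) e t = 0.
Proof.
move=> ht; rewrite combE big1// => i _.
by rewrite (negbTE (ht i (ltn_ord i))) mulr0.
Qed.

Lemma top_avg_comb e n a h k :
  {in [pred i | (i < n)%N] &, injective h} ->
  top_avg k (slice (comb e n a h) e) = top_avg k (cutoff n a).
Proof.
move=> hI; apply/eqP; rewrite eq_le; apply/andP; split.
  (* [g] inverts [h] on the image of the first [n] integers, so both inequalities come from
     [top_avg_inj]. *)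
  pose g t := index t (map h (iota 0 n)).
  have gP t : slice (comb e n a h) e t != 0 -> (g t < n)%N /\ h (g t) = t.
    move=> ft; have : t \in map h (iota 0 n).
      apply: contraR ft => tn; apply/eqP; apply: comb_out => i i_n.
      by apply: contra tn => /eqP->; apply: map_f; rewrite mem_iota.
    move=> tm; have := tm; rewrite -index_mem size_map size_iota -/(g t) => gn.
    split=> //; have := nth_index 0%N tm.
    by rewrite (nth_map 0%N) ?size_iota// nth_iota.
  apply: (@top_avg_inj _ k _ _ _ g (cutoff_bound n a)) =>
    [t /gP[gn gt]|t t' /gP[_ gt] /gP[_ gt'] E].
    by rewrite /cutoff gn -{1}gt comb_at.
  by rewrite -gt -gt' E.
have cn0 i : cutoff n a i != 0 -> (i < n)%N by rewrite /cutoff; case: ifP; rewrite ?eqxx.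
apply: (@top_avg_inj _ k _ _ _ h (slice_bound _ e)) => [i /cn0 i_n|i j /cn0 i_n /cn0 jn].
  by rewrite comb_at// /cutoff i_n.
exact: hI.
Qed.

Lemma level_sum_comb e n a h K :
  {in [pred i | (i < n)%N] &, injective h} ->
  level_sum gam e K (slice (comb e n a h) e) = level_sum gam e K (cutoff n a).
Proof. by move=> hI; apply: eq_bigr => k _; exact: top_avg_comb. Qed.

(** Using the unnormalized vectors [delta] keeps the factor [delta_norm e], which lies between 1 and
    2, out of the estimates. *)
Definition bnorm e n a : R := `|comb e n a id|.

Lemma level_sum_le_bnorm e n a K : level_sum gam e K (cutoff n a) <= bnorm e n a.
Proof.
by rewrite -(@level_sum_comb e n a id) ?level_sum_le_norm.
Qed.

Lemma comb_norm_le e n a h M : {in [pred i | (i < n)%N] &, injective h} ->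
  (forall K, level_sum gam e K (cutoff n a) <= M) -> `|comb e n a h| <= M.
Proof.
move=> hI hM; apply: (@norm_le_level_sum _ _ _ e); first by move=> p; exact: comb_off.
by move=> K; rewrite level_sum_comb.
Qed.

Lemma bnorm_le e n a M :
  (forall K, level_sum gam e K (cutoff n a) <= M) -> bnorm e n a <= M.
Proof. by apply: comb_norm_le => i j. Qed.

Lemma comb_spread e n a h : {in [pred i | (i < n)%N] &, injective h} ->
  `|comb e n a h| = bnorm e n a.
Proof.
move=> hI; apply/eqP; rewrite eq_le; apply/andP; split.
  by apply: comb_norm_le => // K; exact: level_sum_le_bnorm.
by apply: bnorm_le => K; rewrite -(level_sum_comb e a K hI) level_sum_le_norm.
Qed.

Definition count_scales e j : nat := \sum_(0 <= k < j) gam e k.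

Lemma top_avg_cutoff_le k n a : (forall i, `|a i| <= 1) ->
  top_avg k (cutoff n a) <= n%:R / (scale k)%:R.
Proof.
move=> a1; apply: top_avg_le => s /andP[us _].
rewrite /sel_avg mulrC ler_wpM2r ?invr_ge0 ?ler0n//.
rewrite (bigID (fun t => (t < n)%N)) /= [X in _ + X]big1 ?addr0; last first.
  by move=> t /negbTE tn; rewrite /cutoff tn normr0.
rewrite -big_filter; set r := [seq _ <- _ | _].
apply: (@le_trans _ _ (\sum_(t <- r) 1)).
  by apply: ler_sum => t _; rewrite /cutoff; case: ifP; rewrite ?normr0.
rewrite big_const_seq count_predT iter_addr_0 ler_nat.
rewrite -[leqRHS](size_iota 0); apply: uniq_leq_size; first exact: filter_uniq.
by move=> t; rewrite mem_filter mem_iota => /andP[].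
Qed.

(** Below [j] a scale contributes at most 1, the sup norm; from [j] on, only [scale j] coordinates
    are available and the contributions sum geometrically to at most 2. *)
Lemma level_sum_cutoff_le e K j a : (forall i, `|a i| <= 1) ->
  level_sum gam e K (cutoff (scale j) a) <= (count_scales e j)%:R + 2.
Proof.
move=> a1; have cut1 t : `|cutoff (scale j) a t| <= 1.
  by rewrite /cutoff; case: ifP; rewrite ?normr0.
have t0 k : 0 <= top_avg k (cutoff (scale j) a) by exact: top_avg_ge0 cut1.
apply: (@le_trans _ _ (level_sum gam e (j + K) (cutoff (scale j) a))).
  rewrite /level_sum !(big_mkcond (gam e)) /= [leRHS](big_cat_nat (n := K)) ?leq_addl//=.
  by rewrite lerDl sumr_ge0// => k _; case: ifP.
rewrite /level_sum !(big_mkcond (gam e)) /= (big_cat_nat (n := j)) ?leq_addr//=.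
apply: lerD.
  rewrite /count_scales natr_sum; apply: ler_sum => k _.
  by case: (gam e k) => //; exact: top_avg_bound.
pose G k := if gam e k then top_avg k (cutoff (scale j) a) else 0.
rewrite (_ : \sum_(j <= k < j + K) _ = \sum_(0 <= k < K) G (k + j)%N); last first.
  by rewrite -{1}[j]add0n big_addn addKn.
have := @sum_scale_inv R j K; rewrite ler_pdivlMr ?scaleR_gt0//; apply: le_trans.
rewrite mulr_suml; apply: ler_sum => k _; rewrite addnC /G.
case: ifP => _; last by rewrite mulr_ge0 ?invr_ge0 ?ler0n.
by rewrite mulrC; exact: top_avg_cutoff_le.
Qed.

Definition supp n a : seq nat := [seq i <- iota 0 n | a i != 0].

Lemma mem_supp n a i : (i \in supp n a) = (i < n)%N && (a i != 0).
Proof. by rewrite mem_filter mem_iota andbC. Qed.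

Lemma supp_uniq n a : uniq (supp n a).
Proof. by rewrite filter_uniq ?iota_uniq. Qed.

(** A scale no larger than the support can be filled with coordinates of modulus 1. With
    [level_sum_cutoff_le] this determines the norm of a sum of [scale j] basis vectors up to an
    additive 2. *)
Lemma count_scales_le_bnorm e n j a : (forall i, `|a i| = (a i != 0)%:R) ->
  (forall k, (k < j)%N -> (scale k <= size (supp n a))%N) ->
  (count_scales e j)%:R <= bnorm e n a.
Proof.
move=> a1 kn; apply: (le_trans _ (level_sum_le_bnorm e n a j)).
rewrite /level_sum /count_scales natr_sum big_nat [leRHS]big_mkcond [leRHS]big_nat.
apply: ler_sum => k /andP[_ kj]; case: (gam e k) => //.
pose r := take (scale k) (supp n a).
have rk : size r = scale k by rewrite size_take_min; apply/minn_idPl/kn.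
have sel : selection k r by rewrite /selection take_uniq ?supp_uniq// rk /=.
apply: (le_trans _ (sel_avg_le_top (cutoff_bound n a) sel)).
rewrite /sel_avg ler_pdivlMl ?scaleR_gt0// mulr1.
rewrite -[leLHS](_ : \sum_(t <- r) 1 = _); last first.
  by rewrite big_const_seq count_predT iter_addr_0 rk.
rewrite big_seq [leRHS]big_seq; apply: ler_sum => t /mem_take.
by rewrite mem_supp => /andP[tn at0]; rewrite /cutoff tn a1 at0.
Qed.

End Basis.

Arguments count_scales {L} gam e j.
Arguments comb {R L} gam e n a h.
Arguments bnorm {R L} gam e n a.

Section UnitBasis.
Context {R : realType} {L : choiceType} {gam : profile L}.
Implicit Types (v w : @lorentz R L gam) (e : L) (a : nat -> R).

Definition delta_norm e : R := `|@delta R L gam (e, 0%N)|.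

Lemma delta_norm_ge1 e : 1 <= delta_norm e.
Proof. by apply: (le_trans _ (coord_le_norm _ (e, 0%N))); rewrite deltaE eqxx normr1. Qed.

Lemma delta_norm_gt0 e : 0 < delta_norm e.
Proof. by apply: lt_le_trans (delta_norm_ge1 e). Qed.

Lemma norm_delta e t : `|@delta R L gam (e, t)| = delta_norm e.
Proof.
have one s : `|@delta R L gam (e, s)| = bnorm gam e 1 (fun=> 1).
  rewrite -(@comb_spread _ _ _ _ _ _ (fun=> s)).
    by rewrite /comb big_ord1 scale1r.
  by move=> [|i] [|j].
by rewrite /delta_norm !one.
Qed.

Definition unit_vec e (t : nat) : @lorentz R L gam :=
  (delta_norm e)^-1 *: delta (e, t).

Lemma unit_vec_normalized e : normalized (unit_vec e).
Proof.
move=> t; rewrite normrZ norm_delta normfV gtr0_norm ?delta_norm_gt0//.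
by rewrite mulVf// gt_eqF ?delta_norm_gt0.
Qed.

Lemma sum_unit_vec e n a (h : nat -> nat) :
  \sum_(i < n) a i *: unit_vec e (h i) = (delta_norm e)^-1 *: comb gam e n a h.
Proof.
by rewrite /comb scaler_sumr; apply: eq_bigr => i _; rewrite !scalerA mulrC.
Qed.

Lemma norm_sum_unit_vec e n a (h : nat -> nat) : {in [pred i | (i < n)%N] &, injective h} ->
  `|\sum_(i < n) a i *: unit_vec e (h i)| = (delta_norm e)^-1 * bnorm gam e n a.
Proof.
move=> hI; rewrite sum_unit_vec normrZ comb_spread// ger0_norm//.
by rewrite invr_ge0 ltW ?delta_norm_gt0.
Qed.

Lemma unit_vec_generates e : generates (unit_vec e) (unit_vec e).
Proof.
(* The two norms are equal by [comb_spread], so any positive sequence decreasing to zero serves. *)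
exists (fun n => n.+1%:R^-1); split.
- by move=> n; rewrite invr_gt0.
- by move=> m n mn; rewrite lef_pV2 ?posrE// ler_nat.
- exact: cvg_harmonic.
move=> n a k _ _ kmono.
pose h i := k (inord i); pose b i := a (inord i).
have hE : \sum_i a i *: unit_vec e (k i) = \sum_(i < n.+1) b i *: unit_vec e (h i).
  by apply: eq_bigr => i _; rewrite /b /h inord_val.
have bE : `|\sum_i a i *: unit_vec e i| = (delta_norm e)^-1 * bnorm gam e n.+1 b.
  rewrite -(@norm_sum_unit_vec e n.+1 b id)//; congr `|_|.
  by apply: eq_bigr => i _; rewrite /b inord_val.
rewrite hE bE norm_sum_unit_vec ?subrr ?normr0 ?invr_gt0//.
move=> i j; rewrite !inE /h => i_n jn kij.
have : inord i = inord j :> 'I_n.+1.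
  case: (ltngtP (inord i : 'I_n.+1) (inord j : 'I_n.+1)) => [/kmono|/kmono|/val_inj//];
  by rewrite kij ltnn.
by move/(congr1 val); rewrite /= !inordK.
Qed.

Definition proj e n v : @lorentz R L gam := comb gam e n (slice v e) id.

Lemma projB e n v w : proj e n (v - w) = proj e n v - proj e n w.
Proof. by rewrite /proj /comb -sumrB; apply: eq_bigr => i _; rewrite -scalerBl. Qed.

Lemma norm_proj e n v : `|proj e n v| <= `|v|.
Proof.
apply: bnorm_le => K; apply: (le_trans _ (level_sum_le_norm e K v)).
apply: ler_sum => k _; apply: (@top_avg_mono _ k _ (slice v e) `|v| (slice_bound v e)) => t.
by rewrite /cutoff; case: ifP; rewrite ?normr0.
Qed.

Lemma proj_comb e m n a : (m <= n)%N ->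
  proj e n (comb gam e m a id) = comb gam e m a id.
Proof.
move=> mn; apply: val_inj; apply/funext => -[e' t] /=.
have [->|ee] := eqVneq e' e; last by rewrite !comb_off.
rewrite -[LHS]/(slice _ e t) -[RHS]/(slice _ e t).
have [tn|nt] := ltnP t n; first exact: (@comb_at _ _ _ e n _ id).
by rewrite !comb_out//= => i i_n; rewrite neq_ltn (leq_trans i_n) ?orbT// (leq_trans mn).
Qed.

Lemma unit_vec_basic e : basic (unit_vec e).
Proof.
move=> v vcl; pose a i := v (e, i) * delta_norm e.
have seriesE (b : nat -> R) n :
    series (fun i => b i *: unit_vec e i) n = (delta_norm e)^-1 *: comb gam e n b id.
  by rewrite /series /= big_mkord (sum_unit_vec e n b (@id nat)).
exists a; split.
  apply/cvgrPdist_le => eps eps0.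
  have [w [[m [b wE]]]] := vcl _ (nbhsx_ballx v (eps / 2) (divr_gt0 eps0 (ltr0Sn _ 1))).
  rewrite -ball_normE /= => vw.
  exists m => // n /= mn.
  have -> : series (fun i => a i *: unit_vec e i) n = proj e n v.
    rewrite seriesE /proj /comb scaler_sumr; apply: eq_bigr => i _.
    by rewrite scalerA /a mulrC mulfK// gt_eqF ?delta_norm_gt0.
  have wP : proj e n w = w.
    have -> : w = comb gam e m (fun i => (delta_norm e)^-1 * b i) id.
      rewrite wE (sum_unit_vec e m b (@id nat)) /comb scaler_sumr.
      by apply: eq_bigr => i _; rewrite scalerA.
    exact: proj_comb.
  (* The projection fixes [w] and is a contraction, so its error at [v] is at most twice the
     distance to [w]. *)
  have -> : v - proj e n v = (v - w) - proj e n (v - w).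
    by rewrite projB wP opprB addrC addrA subrK addrC.
  apply: le_trans (ler_normB _ _) _; rewrite [leRHS]splitr; apply: lerD; first exact: ltW.
  by apply: le_trans (norm_proj _ _ _) _; exact: ltW.
move=> b bv; apply/funext => i.
have key : v (e, i) = (delta_norm e)^-1 * b i.
  apply/eqP; rewrite -subr_eq0 -normr_le0; apply/ler_addgt0Pr => eps eps0; rewrite add0r.
  have /cvgrPdist_le/(_ eps eps0)[N _ Nb] := bv.
  have /= := Nb (maxn N i.+1) (leq_maxl _ _); apply: le_trans.
  have := coord_le_norm (v - series (fun i => b i *: unit_vec e i) (maxn N i.+1)) (e, i).
  apply: le_trans; rewrite le_eqVlt; apply/orP; left; apply/eqP; congr `|_|.
  rewrite seriesE -[RHS]/(v (e, i) - (delta_norm e)^-1 * slice (comb gam e _ b id) e (id i)).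
  by rewrite comb_at// leq_maxr.
by rewrite /a key mulrC mulrA mulfV ?mul1r// gt_eqF ?delta_norm_gt0.
Qed.

End UnitBasis.
Arguments delta_norm {R L} gam e.

(** * Weak nullness of the unit bases and domination between them *)

Section UnitBasisOrder.
Context {R : realType} {L : choiceType} {gam : profile L}.
Implicit Types (e : L) (a : nat -> R).

Lemma scale_gt_id j : (j < scale j)%N.
Proof.
elim: j => // j IH; apply: leq_trans (scale_double j).
by rewrite mul2n -addnn -addn1 leq_add// (leq_trans _ IH).
Qed.

Lemma count_scales_le e j : (count_scales gam e j <= j)%N.
Proof.
apply: (@leq_trans (\sum_(0 <= k < j) 1)); last by rewrite sum_nat_const_nat subn0 muln1.
by apply: leq_sum => k _; exact: leq_b1.
Qed.

Lemma continuous_functional_bound {V : normedModType R} (f : {linear V -> R^o}) :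
  continuous f -> exists2 M : R, 0 < M & forall x, `|f x| <= M * `|x|.
Proof.
move=> /linear_bounded_continuous/linear_boundedP/pinfty_ex_gt0[M M0 h].
by exists M.
Qed.

(** A functional at least [d] in modulus on infinitely many basis vectors would be at least
    [d * scale j] on a signed sum of [scale j] of them, whose norm is at most [j + 2]. *)
Lemma unit_vec_weakly_null e : weakly_null (@unit_vec R L gam e).
Proof.
move=> f /continuous_functional_bound[M M0 fM].
apply/cvgrPdist_lt => d d0; apply: contrapT => nf.
have big K : exists2 t, (K <= t)%N & d <= `|f (unit_vec e t)|.
  apply: contrapT => nK; apply: nf; exists K => // t /= Kt.
  rewrite sub0r normrN ltNge; apply/negP => dt.
  by apply: nK; exists t.
have bound j : d * (scale j)%:R <= M * (j%:R + 2).
  have [s [us sj sd]] := unbounded_uniq_seq big (scale j).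
  pose a i : R := Num.sg (f (unit_vec e (nth 0%N s i))).
  have a1 i : `|a i| <= 1 by rewrite normr_sg; case: (_ == _).
  have hI : {in [pred i | (i < scale j)%N] &, injective (nth 0%N s)}.
    by move=> i i'; rewrite !inE -sj => i_s i's /eqP; rewrite nth_uniq// => /eqP.
  have := fM (\sum_(i < scale j) a i *: unit_vec e (nth 0%N s i)).
  rewrite norm_sum_unit_vec// linear_sum => h.
  have {h} : d * (scale j)%:R <= M * ((delta_norm gam e)^-1 * bnorm gam e (scale j) a).
    apply: (le_trans _ h); apply: (le_trans _ (ler_norm _)).
    rewrite -[leLHS](_ : \sum_(i < scale j) d = _); last first.
      by rewrite big_const_ord iter_addr_0 mulr_natr.
    apply: ler_sum => i _; rewrite linearZ /= /GRing.scale /= -normrEsg.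
    by apply: sd; rewrite mem_nth// sj.
  move/le_trans; apply; rewrite ler_pM2l//.
  have b2 : bnorm gam e (scale j) a <= j%:R + 2.
    apply: bnorm_le => K; apply: le_trans (level_sum_cutoff_le e K j a1) _.
    by rewrite lerD2r ler_nat count_scales_le.
  apply: (le_trans _ b2); rewrite ler_pdivrMl ?delta_norm_gt0//.
  by rewrite ler_peMl ?delta_norm_ge1//; exact: normr_ge0.
(* With n = [j.+1], the chain d n^2 <= d N_n <= M (n + 2) <= 3 M n fails once n > 3 M / d. *)
pose j := Num.truncn (3 * M / d).
have jb : 3 * M / d < j.+1%:R by exact: truncnS_gt.
have := bound j.+1; rewrite leNgt => /negP; apply.
apply: (@lt_le_trans _ _ (d * (j.+1 * j.+1)%:R)); last first.
  rewrite ler_pM2l// ler_nat (leq_trans _ (scale_square j))//.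
  by rewrite mulnn leq_exp2r// scale_gt_id.
rewrite ltr_pdivrMr // in jb; rewrite natrM.
have jge : (1 : R) <= j.+1%:R by rewrite ler1n.
nra.
Qed.

Definition unit_nbseq e : nbseq R :=
  NBSeq (@unit_vec_normalized R L gam e) (@unit_vec_basic R L gam e).

Lemma unit_spreading_model e :
  spreading_model_w (@lorentz R L gam) (unit_nbseq e).
Proof.
exists (unit_vec e); split.
- exact: unit_vec_normalized.
- exact: unit_vec_basic.
- exact: unit_vec_weakly_null.
- exact: unit_vec_generates.
Qed.

Lemma norm_sum_unit_vecE e n a :
  `|\sum_(i < n) a i *: @unit_vec R L gam e i| = (delta_norm gam e)^-1 * bnorm gam e n a.
Proof. by rewrite (@norm_sum_unit_vec _ _ _ e n a id). Qed.

Lemma norm_sum_unit_vec_le e n a :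
  `|\sum_(i < n) a i *: @unit_vec R L gam e i| <= bnorm gam e n a.
Proof.
rewrite norm_sum_unit_vecE ler_pdivrMl ?delta_norm_gt0//.
by rewrite ler_peMl ?delta_norm_ge1//; exact: normr_ge0.
Qed.

Lemma bnorm_le_unit_vec e n a :
  bnorm gam e n a = delta_norm gam e * `|\sum_(i < n) a i *: @unit_vec R L gam e i|.
Proof.
by rewrite norm_sum_unit_vecE mulrA mulfV ?mul1r// gt_eqF ?delta_norm_gt0.
Qed.

Lemma bnorm_mono e e' n a : (forall k, gam e k -> gam e' k) ->
  bnorm gam e n a <= bnorm gam e' n a.
Proof.
move=> ee'; apply: bnorm_le => K; apply: (le_trans _ (level_sum_le_bnorm e' n a K)).
rewrite /level_sum [leLHS]big_mkcond [leRHS]big_mkcond; apply: ler_sum => k _.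
have t0 : 0 <= top_avg k (cutoff n a) by exact: top_avg_ge0 (cutoff_bound n a).
by case: ifP => [/ee'->//|_]; case: ifP.
Qed.

Lemma bnorm_join e e' g n a : (forall k, gam g k -> gam e k || gam e' k) ->
  bnorm gam g n a <= bnorm gam e n a + bnorm gam e' n a.
Proof.
move=> gE; apply: bnorm_le => K.
apply: (le_trans _ (lerD (level_sum_le_bnorm e n a K) (level_sum_le_bnorm e' n a K))).
rewrite /level_sum !(big_mkcond (gam _)) -big_split /=; apply: ler_sum => k _.
have t0 : 0 <= top_avg k (cutoff n a) by exact: top_avg_ge0 (cutoff_bound n a).
by have := gE k; case: (gam g k); case: (gam e k); case: (gam e' k) => //=;
  rewrite ?addr0 ?add0r ?lerDl ?addr_ge0// => /(_ isT).
Qed.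

Lemma dominates_bnorm {Y : completeNormedModType R} (y : nat -> Y) e (C : R) :
  (forall n a, bnorm gam e n a <= C * `|\sum_(i < n) a i *: y i|) ->
  dominates y (@unit_vec R L gam e).
Proof.
by move=> h; exists C => n a; apply: le_trans (norm_sum_unit_vec_le _ _ _) _.
Qed.

Lemma dominates_unitP {Y : completeNormedModType R} (y : nat -> Y) e :
  dominates y (@unit_vec R L gam e) -> exists2 C : R, 0 < C &
  forall n a, bnorm gam e n a <= C * `|\sum_(i < n) a i *: y i|.
Proof.
move=> [C h]; exists (delta_norm gam e * (`|C| + 1)).
  by rewrite mulr_gt0 ?delta_norm_gt0// ltr_wpDl.
move=> n a; rewrite bnorm_le_unit_vec -mulrA ler_pM2l ?delta_norm_gt0//.
apply: le_trans (h n a) _; rewrite ler_wpM2r//.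
by rewrite (le_trans (ler_norm _))// lerDl.
Qed.

Lemma dominates_unit_mono e e' : (forall k, gam e k -> gam e' k) ->
  dominates (@unit_vec R L gam e') (@unit_vec R L gam e).
Proof.
move=> ee'; apply: (@dominates_bnorm _ _ _ (delta_norm gam e')) => n a.
by rewrite -bnorm_le_unit_vec; exact: bnorm_mono.
Qed.

Lemma dominates_unit_join {Y : completeNormedModType R} (y : nat -> Y) e e' g :
  (forall k, gam g k -> gam e k || gam e' k) ->
  dominates y (@unit_vec R L gam e) -> dominates y (@unit_vec R L gam e') ->
  dominates y (@unit_vec R L gam g).
Proof.
move=> gE /dominates_unitP[C _ hC] /dominates_unitP[D _ hD].
apply: (@dominates_bnorm _ _ _ (C + D)) => n a.
apply: le_trans (bnorm_join n a gE) _; rewrite mulrDl.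
by apply: lerD; [exact: hC|exact: hD].
Qed.

(** The domination is tested on the vector of [scale j] ones; the [.+2] comes from the scales from
    [j] on. *)
Lemma dominates_unit_count e e' :
  dominates (@unit_vec R L gam e') (@unit_vec R L gam e) ->
  exists C : nat, forall j,
    (count_scales gam e j <= C * (count_scales gam e' j).+2)%N.
Proof.
move=> /dominates_unitP[C C0 hC]; exists (Num.truncn C).+1 => j.
rewrite -(ler_nat R) natrM.
pose a (i : nat) : R := 1.
have a1 i : `|a i| = 1 by rewrite normr1.
have sz : size (supp (scale j) a) = scale j.
  rewrite size_filter -[RHS](size_iota 0); apply/eqP; rewrite -all_count.
  by apply/allP => i _; rewrite /a oner_neq0.
apply: le_trans (count_scales_le_bnorm (gam := gam) (n := scale j) (a := a) e _ _) _.
- by move=> i; rewrite a1 /a oner_neq0.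
- by move=> k kj; rewrite sz; apply: scale_le; exact: ltnW.
apply: le_trans (hC _ _) _; apply: ler_pM; [exact: ltW|exact: normr_ge0| |].
  by apply: ltW; exact: truncnS_gt.
apply: le_trans (norm_sum_unit_vec_le _ _ _) _; apply: bnorm_le => K.
have a1' i : `|a i| <= 1 by rewrite a1.
apply: le_trans (level_sum_cutoff_le e' K j a1') _.
by rewrite -natrD addn2.
Qed.

End UnitBasisOrder.

(** * Uniform tails of weakly null sequences *)

Lemma weakly_null_functional {R : realType} {X : completeNormedModType R}
    (x : nat -> X) (phi : X -> R) (M : R) : weakly_null x ->
  (forall c u v, phi (c *: u + v) = c * phi u + phi v) ->
  (forall v, `|phi v| <= M * `|v|) ->
  phi (x n) @[n --> \oo] --> (0 : R).
Proof.
move=> xw phiL phiM.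
pose phi' : X -> R^o := phi.
have phiL' : linear phi' by move=> c u v; rewrite /phi' phiL.
pose f : {linear X -> R^o} := HB.pack phi' (GRing.isLinear.Build R X R^o _ phi' phiL').
apply: (xw f); apply: bounded_linear_continuous; apply/linear_boundedP.
exists M; split; first exact: num_real.
by move=> r Mr v; apply: le_trans (phiM v) _; rewrite ler_wpM2r// ltW.
Qed.

Section Tail.
Context {R : realType} {L : choiceType} {gam : profile L}.
Implicit Types (u v w : @lorentz R L gam) (F G : seq (L * nat)).

Lemma weakly_null_coord (x : nat -> @lorentz R L gam) p : weakly_null x ->
  x n p @[n --> \oo] --> (0 : R).
Proof.
move=> xw; apply: (@weakly_null_functional _ _ x (fun v => v p) 1 xw) => //.
by move=> v; rewrite mul1r coord_le_norm.
Qed.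

Definition top_sum F v : R := \sum_(p <- F) top_avg p.2 (slice v p.1).

Lemma top_avg_slice_ge0 k v e : 0 <= top_avg k (slice v e).
Proof. exact: top_avg_ge0 (slice_bound v e). Qed.

Lemma active_cat F G : active gam F -> active gam G ->
  {in G, forall p, p \notin F} -> active gam (F ++ G).
Proof.
move=> /andP[uF aF] /andP[uG aG] FG; rewrite /active cat_uniq uF uG all_cat aF aG !andbT.
by apply/hasPn => p /FG.
Qed.

(** A finite set nearly attaining the norm leaves at most [eta] to any finite set disjoint from it,
    because the norm bounds the sum over their union. *)
Lemma top_sum_tail v (eta : R) : 0 < eta -> exists F, forall G, active gam G ->
  {in G, forall p, p \notin F} -> top_sum G v <= eta.
Proof.
move=> eta0; have [r [F [s [aF hs ->]]] hr] := sup_adherent eta0 (evs_has_sup v).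
exists F => G aG FG; have := sum_top_le_norm v (active_cat aF aG FG).
rewrite big_cat /= => h.
have evF : ev F s v <= \sum_(p <- F) top_avg p.2 (slice v p.1).
  by apply: ler_sum => p _; exact: sel_avg_le_top (slice_bound v p.1) (hs p).
have := lerD evF (lexx (top_sum G v)) => /le_trans/(_ h).
rewrite -lerBrDl => /le_trans; apply.
by rewrite lerBlDr -lerBlDl ltW.
Qed.

(** Linearization of [ev F s] at [w]: moduli are replaced by products with the signs of [w]. *)
Definition hump F (s : L * nat -> seq nat) w v : R :=
  \sum_(p <- F) (scale p.2)%:R^-1 * \sum_(t <- s p) Num.sg (w (p.1, t)) * v (p.1, t).

Lemma hump_linear F s w c u v : hump F s w (c *: u + v) = c * hump F s w u + hump F s w v.
Proof.
rewrite /hump mulr_sumr -big_split /=; apply: eq_bigr => p _.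
rewrite mulrCA -mulrDr; congr (_ * _); rewrite mulr_sumr -big_split /=.
by apply: eq_bigr => t _; rewrite mulrCA -mulrDr.
Qed.

Lemma hump_self F s w : hump F s w w = ev F s w.
Proof.
by apply: eq_bigr => p _; congr (_ * _); apply: eq_bigr => t _; rewrite -normrEsg.
Qed.

Lemma hump_le F s w v : selections s -> `|hump F s w v| <= top_sum F v.
Proof.
move=> hs; apply: le_trans (ler_norm_sum _ _ _) _; apply: ler_sum => p _.
apply: (le_trans _ (sel_avg_le_top (slice_bound v p.1) (hs p))).
rewrite normrM ger0_norm ?invr_ge0 ?ler0n// ler_wpM2l ?invr_ge0 ?ler0n//.
apply: le_trans (ler_norm_sum _ _ _) _; apply: ler_sum => t _.
by rewrite normrM normr_sg; case: (_ != _); rewrite ?mul1r ?mul0r.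
Qed.

(* State of the gliding hump construction: [stage_fun] is the sum of the humps
   so far, [stage_used] lists the indices they involve, and [stage_avoid] also
   contains those carrying almost all of the norm of [x stage_index]. *)
Record stage := Stage {
  stage_avoid : seq (L * nat);
  stage_used : seq (L * nat);
  stage_fun : @lorentz R L gam -> R;
  stage_index : nat }.

Section GlidingHump.
Variables (x : nat -> @lorentz R L gam) (xw : weakly_null x) (eps : R) (eps0 : 0 < eps).

Definition stage_ok (st : stage) : Prop :=
  [/\ active gam (stage_used st), {subset stage_used st <= stage_avoid st},
      (forall c u v, stage_fun st (c *: u + v) = c * stage_fun st u + stage_fun st v) &
      (forall v, `|stage_fun st v| <= top_sum (stage_used st) v)].

(** Origin of the constants: the new hump exceeds eps at [w], the old functional is at most eps / 2
    in modulus there by weak nullness, and later humps avoid the pairs where [w] is large, hence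
    change the value by at most eps / 4. The limit functional stays at least eps / 4 at infinitely
    many terms. *)
Definition stage_next (st st' : stage) : Prop :=
  let w := x (stage_index st') in
  exists G, [/\ active gam G, {in G, forall p, p \notin stage_avoid st},
    stage_used st' = stage_used st ++ G,
    (forall v, `|stage_fun st' v - stage_fun st v| <= top_sum G v) &
  [/\ {subset stage_avoid st <= stage_avoid st'},
      (stage_index st < stage_index st')%N,
      eps / 2 <= stage_fun st' w &
      forall G', active gam G' -> {in G', forall p, p \notin stage_avoid st'} ->
        top_sum G' w <= eps / 4]].

Lemma stage_step (st : stage) : stage_ok st ->
  (forall F N, exists n G, [/\ (N <= n)%N, active gam G,
      {in G, forall p, p \notin F} & eps < top_sum G (x n)]) ->
  exists st', stage_ok st' /\ stage_next st st'.
Proof.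
move=> [aA AF PhiL PhiB] neg.
have Phi0 : stage_fun st (x n) @[n --> \oo] --> (0 : R).
  apply: (weakly_null_functional (M := 1) xw PhiL) => v.
  by rewrite mul1r (le_trans (PhiB v))// sum_top_le_norm.
have /cvgrPdist_le/(_ (eps / 2) (divr_gt0 eps0 (ltr0Sn _ 1)))[N _ hN] := Phi0.
have [n [G [Nn aG FG xG]]] := neg (stage_avoid st) (maxn N (stage_index st).+1).
have [s hs sG] : exists2 s, selections s & eps < ev G s (x n).
  apply: contrapT => nex; move: xG; rewrite ltNge => /negP; apply.
  apply: sum_top_avg_le; first by case/andP: aG.
  move=> s hs; rewrite leNgt; apply/negP => h; apply: nex; by exists s.
have [F' hF'] := top_sum_tail (x n) (divr_gt0 eps0 (ltr0Sn _ 3)).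
exists (Stage (stage_avoid st ++ G ++ F') (stage_used st ++ G)
  (fun v => stage_fun st v + hump G s (x n) v) n); split.
  split => /=.
  - by apply: active_cat => // p pG; apply: contra (FG p pG); exact: AF.
  - by move=> p; rewrite !mem_cat => /orP[/AF->//|->]; rewrite orbT.
  - by move=> c u v; rewrite PhiL hump_linear mulrDr addrACA.
  - move=> v; rewrite /top_sum big_cat /=.
    by apply: le_trans (ler_normD _ _) _; apply: lerD; [exact: PhiB|exact: hump_le].
exists G; split => //=.
  by move=> v; rewrite addrC addKr; exact: hump_le.
split.
- by move=> p; rewrite mem_cat => ->.
- by apply: leq_trans Nn; rewrite leq_maxr.
- have := hN n (leq_trans (leq_maxl _ _) Nn); rewrite /= sub0r normrN hump_self.
  move=> /ler_normlP[h _]; lra.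
- move=> G' aG' h; apply: hF' => // p /h.
  by rewrite !mem_cat !negb_or => /andP[_ /andP[]].
Qed.

Lemma weakly_null_tail : exists F N, forall n G, (N <= n)%N -> active gam G ->
  {in G, forall p, p \notin F} -> top_sum G (x n) <= eps.
Proof.
apply: contrapT => /forallNP nex.
have neg F N : exists n G, [/\ (N <= n)%N, active gam G,
    {in G, forall p, p \notin F} & eps < top_sum G (x n)].
  apply: contrapT => h; apply: (nex F); exists N => n G Nn aG FG.
  by rewrite leNgt; apply/negP => lt; apply: h; exists n, G.
pose st0 := Stage [::] [::] (fun=> 0) 0.
have ok0 : stage_ok st0.
  split => //= [c u v|v]; first by rewrite mulr0 addr0.
  by rewrite normr0 /top_sum big_nil.
have step (st : {st | stage_ok st}) :
    {st' : {st | stage_ok st} | stage_next (sval st) (sval st')}.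
  case: st => st ok /=; apply: cid; have [st' [ok' nx]] := stage_step ok neg.
  by exists (exist _ st' ok').
have [S [_ Snext]] := dependent_choice step (exist _ st0 ok0).
pose st j := sval (S j).
have stok j : stage_ok (st j) := svalP (S j).
have stn j : stage_next (st j) (st j.+1) := Snext j.
(* Everything added after stage [j] avoids [stage_avoid (st j)], so the tail bound of stage [j]
   limits its effect on the vector of that stage. *)
have tele j m : (j <= m)%N -> exists B, [/\ stage_used (st m) = stage_used (st j) ++ B,
    {in B, forall p, p \notin stage_avoid (st j)},
    {subset stage_avoid (st j) <= stage_avoid (st m)} &
    forall v, `|stage_fun (st m) v - stage_fun (st j) v| <= top_sum B v].
  move=> /subnK <-; elim: (m - j)%N => [|i [B [B1 B2 B3 B4]]].
    exists [::]; split => // [|v]; first by rewrite cats0.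
    by rewrite subrr normr0 /top_sum big_nil.
  have [G [aG GF used fG [avoid _ _ _]]] := stn (i + j)%N.
  exists (B ++ G); split => [| | |v].
  - by rewrite addSn used B1 catA.
  - move=> p; rewrite mem_cat => /orP[/B2//|pG].
    by apply: contra (GF p pG); exact: B3.
  - by move=> p /B3/avoid.
  - rewrite /top_sum big_cat /= addSn.
    rewrite -(subrK (stage_fun (st (i + j)) v) (stage_fun (st (i + j).+1) v)) -addrA.
    by apply: le_trans (ler_normD _ _) _; rewrite [leRHS]addrC; apply: lerD; [exact: fG|exact: B4].
have used_active j : active gam (stage_used (st j)) by case: (stok j).
pose Phi j v := stage_fun (st j) v.
(* [Phi] need not be monotone, but its increments are bounded by those of the bounded nondecreasing
   [T], so [T] and [T - Phi] are both monotone and bounded. *)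
have Phi_cvg v : cvg (Phi j v @[j --> \oo]).
  pose T j := top_sum (stage_used (st j)) v.
  have TB j : T j <= `|v| by exact: sum_top_le_norm.
  have step_le j m : (j <= m)%N -> `|Phi m v - Phi j v| <= T m - T j.
    move=> /tele[B [used _ _ fB]]; apply: le_trans (fB v) _.
    by rewrite /T used /top_sum big_cat /= addrAC subrr add0r.
  have Tcvg : cvgn T.
    apply: nondecreasing_is_cvgn.
      by move=> j m /step_le h; rewrite -subr_ge0 (le_trans _ h).
    by exists `|v| => _ [j _ <-].
  have Dcvg : cvgn (fun j => T j - Phi j v).
    apply: nondecreasing_is_cvgn.
      move=> j m /step_le/ler_normlP[_ h]; rewrite -subr_ge0; move: h; rewrite -subr_ge0.
      by congr (_ <= _); ring.
    exists (2 * `|v|) => _ [j _ <-]; have [_ _ _ /(_ v) h] := stok j.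
    have := TB j; rewrite -/(T j) in h; move: h => /ler_normlP[h _] hT.
    by rewrite mulr2n mulrDl mul1r lerD// (le_trans h).
  have -> : (fun j => Phi j v) = T \- (fun j => T j - Phi j v).
    by apply/funext => j /=; rewrite opprB addrC subrK.
  exact: is_cvgB Tcvg Dcvg.
pose f v : R := lim (Phi j v @[j --> \oo]).
have fP v : Phi j v @[j --> \oo] --> f v by exact: Phi_cvg.
have fL c u v : f (c *: u + v) = c * f u + f v.
  have lhs : Phi j (c *: u + v) @[j --> \oo] --> c * f u + f v.
    have -> : (fun j => Phi j (c *: u + v)) = (fun j => c * Phi j u + Phi j v).
      by apply/funext => j; have [_ _ lin _] := stok j; exact: lin.
    by apply: cvgD; [apply: cvgM; [exact: cvg_cst|exact: fP]|exact: fP].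
  exact: (cvg_lim (@norm_hausdorff _ R^o) lhs).
have fB v : `|f v| <= 1 * `|v|.
  apply: (cvgr_to_le (cvg_norm (fP v))); apply: nearW => j.
  have [_ _ _ /(_ v) h] := stok j; rewrite mul1r.
  by apply: le_trans h _; exact: sum_top_le_norm.
have /cvgrPdist_lt/(_ (eps / 4) (divr_gt0 eps0 (ltr0Sn _ 3)))[N _ hN] :=
  weakly_null_functional xw fL fB.
have index_ge j : (j <= stage_index (st j))%N.
  by elim: j => // j IH; have [G [_ _ _ _ [_ h _ _]]] := stn j; exact: leq_ltn_trans h.
have [G [_ _ _ _ [_ _ big tail]]] := stn N.
set w := x _ in big tail.
have := hN (stage_index (st N.+1)) (ltnW (index_ge N.+1)).
rewrite /= sub0r normrN -/w => fsmall.
have : eps / 2 - eps / 4 <= f w.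
  apply: (cvgr_to_ge (fP w)); exists N.+1 => // m /= Nm.
  have [B [used BF _ /(_ w) fB']] := tele _ _ Nm.
  have aB : active gam B.
    have := used_active m; rewrite used /active cat_uniq all_cat.
    by move=> /andP[/and3P[_ _ ->] /andP[_ ->]].
  have := le_trans fB' (tail B aB BF) => /ler_normlP[h _].
  move: h big; rewrite /Phi; move: (stage_fun _ w) (stage_fun _ w) => a b; lra.
move: fsmall => /ltr_normlP[_]; lra.
Qed.

End GlidingHump.

End Tail.

(** * Spreading models of weakly null sequences *)

Section Ultralimit.
Context {R : realType} (U : set_system nat) {UU : UltraFilter U}.

(** Along an ultrafilter every bounded sequence converges, so the limits for all pairs (e, k) exist
    at once without extracting subsequences. *)
Definition ulim (h : nat -> R) : R := lim (h @ U).

Lemma ulimP (h : nat -> R) (M : R) : (forall n, `|h n| <= M) -> h @ U --> ulim h.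
Proof.
move=> hM; suff : cvg (h @ U) by [].
have hI : (h @ U) `[- M, M]%classic.
  by apply: nearW => n /=; rewrite in_itv /= -ler_norml.
have [p [_ clp]] := @segment_compact R (- M) M _ _ hI.
apply/cvg_ex; exists p => A Ap.
have [//|UA] := in_ultra_setVsetC (h @^-1` A) UU.
by have [q []] := clp (~` A) A UA Ap.
Qed.

(** Finitely many [U]-large sets have a common point, so each new index can be made compatible with
    all earlier ones. *)
Lemma filter_increasing_choice (P : set nat) (Q : nat -> set nat) :
  U P -> (forall i, U (Q i)) ->
  exists k : nat -> nat, (forall i, P (k i)) /\
    (forall i j, (i < j)%N -> Q (k i) (k j)).
Proof.
move=> UP UQ.
have UQs (l : seq nat) : U [set n | forall i, i \in l -> Q i n].
  elim: l => [|i l IH]; first by apply: nearW.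
  apply: filterS (filterI (UQ i) IH) => n [Qin Qn] j.
  by rewrite inE => /predU1P[->//|]; exact: Qn.
(* The state lists all earlier choices, latest first, because dependent choice only sees the
   previous state. *)
pose next (l l' : seq nat) := exists n, [/\ l' = n :: l, P n & forall i, i \in l -> Q i n].
have step (l : seq nat) : {l' | next l l'}.
  apply: cid; have [n [Pn Qn]] := filter_ex (filterI UP (UQs l)).
  by exists (n :: l), n.
have [l [_ lP]] := dependent_choice step [::].
pose k j := head 0%N (l j.+1).
have kP j : [/\ l j.+1 = k j :: l j, P (k j) & forall i, i \in l j -> Q i (k j)].
  by have [n [E Pn Qn]] := lP j; rewrite /k E.
have kl i j : (i < j)%N -> k i \in l j.
  elim: j => // j IH; rewrite ltnS leq_eqVlt; have [-> _ _] := kP j.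
  by rewrite inE => /predU1P[->|/IH->]; rewrite ?eqxx ?orbT.
exists k; split=> [i|i j ij]; first by have [] := kP i.
by have [_ _] := kP j; apply; exact: kl.
Qed.

End Ultralimit.

(** Arbitrary coefficients are rescaled by [M] into [-1, 1] and padded with zeros to [(maxn n N).+1]
    terms, because the error [eps] is small only for many terms. *)
Lemma generates_limit {R : realType} {X Y : completeNormedModType R}
    (x : nat -> X) (y : nat -> Y) n (a : nat -> R) (eta : R) :
  generates x y -> 0 < eta -> exists N : nat, forall k : nat -> nat,
    (forall i j, (i < j)%N -> (k i < k j)%N) -> (N <= k 0)%N ->
    `| `|\sum_(i < n) a i *: x (k i)| - `|\sum_(i < n) a i *: y i| | < eta.
Proof.
move=> [eps [eps0 _ epsc gen]] eta0.
pose M := 1 + \sum_(i < n) `|a i|.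
have M0 : 0 < M by rewrite ltr_pwDl// sumr_ge0.
have /cvgrPdist_lt/(_ (eta / M) (divr_gt0 eta0 M0))[N _ hN] := epsc.
exists (maxn n N) => k kmono kN.
pose b i := if (i < n)%N then a i / M else 0.
have b1 i : -1 <= b i <= 1.
  rewrite -ler_norml /b; case: ifP => [i_n|_]; last by rewrite normr0.
  rewrite normrM normfV (gtr0_norm M0) ler_pdivrMr// mul1r /M (bigD1 (Ordinal i_n))//=.
  by rewrite addrCA lerDl addr_ge0// sumr_ge0.
have sumE (Z : completeNormedModType R) (z : nat -> Z) :
    \sum_(i < (maxn n N).+1) b i *: z i = M^-1 *: \sum_(i < n) a i *: z i.
  have nN : (n <= (maxn n N).+1)%N by rewrite leqW// leq_maxl.
  rewrite [in RHS](big_ord_widen _ (fun i => a i *: z i) nN) scaler_sumr [RHS]big_mkcond /=.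
  apply: eq_bigr => i _; rewrite /b; case: ifP => _; last by rewrite scale0r.
  by rewrite scalerA mulrC.
have := gen (maxn n N) (fun i => b i) (fun i => k i) (fun i => b1 i) kN
  (fun i j ij => kmono i j ij).
rewrite (sumE _ (fun i => x (k i))) (sumE _ y) !normrZ -mulrBr normrM normr_id.
rewrite normfV (gtr0_norm M0).
rewrite ltr_pdivrMl// => /lt_trans; apply.
have := hN (maxn n N) (leq_maxr _ _); rewrite /= sub0r normrN gtr0_norm//.
by rewrite ltr_pdivlMr// mulrC.
Qed.

Section AverageError.
Context {R : realType}.
Implicit Types (f g : nat -> R) (k : nat) (s : seq nat).

Lemma top_avgZ k c f (M : R) : (forall t, `|f t| <= M) ->
  top_avg k (fun t => c * f t) = `|c| * top_avg k f.
Proof.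
move=> fM; apply/eqP; rewrite eq_le; apply/andP; split.
  by apply: top_avg_le => s sk; rewrite sel_avgZ ler_wpM2l//; exact: sel_avg_le_top fM sk.
have [->|c0] := eqVneq c 0.
  rewrite normr0 mul0r; apply: (@top_avg_ge0 _ _ _ 0) => t.
  by rewrite mul0r normr0.
rewrite mulrC -ler_pdivlMr ?normr_gt0//; apply: top_avg_le => s sk.
rewrite ler_pdivlMr ?normr_gt0// mulrC -sel_avgZ.
by apply: (@sel_avg_le_top _ _ _ _ (`|c| * M)) => // t; rewrite normrM ler_wpM2l.
Qed.

End AverageError.

(** * Lower estimates for spreading models *)

Section Lower.
Context {R : realType} {L : choiceType} {gam : profile L}.
Implicit Types (v w : @lorentz R L gam) (e : L).

(** Beyond some [T] the coordinates of [v] are small; the finitely many coordinates before [T] tend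
    to zero along [x]. *)
Lemma eventually_disjoint (x : nat -> @lorentz R L gam) v e (eta : R) :
  weakly_null x -> 0 < eta ->
  \forall n \near \oo, forall t, `|v (e, t)| < eta \/ `|x n (e, t)| < eta.
Proof.
move=> xw eta0; have [T vT] := coord_small v e eta0.
have : \forall n \near \oo, forall t, (t < T)%N -> `|x n (e, t)| < eta.
  elim: T {vT} => [|T IH]; first by apply: nearW.
  have /cvgrPdist_lt/(_ eta eta0) h := weakly_null_coord (e, T) xw.
  apply: filterS2 IH h => n hn; rewrite sub0r normrN => hT t.
  by rewrite ltnS leq_eqVlt => /predU1P[->|/hn].
apply: filterS => n hn t; have [tT|Tt] := ltnP t T; first by right; exact: hn.
by left; exact: vT.
Qed.

(** Along a sparse subsequence each [x (k i)] has a coordinate [t i] of modulus above sigma / 2 at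
    which the other chosen vectors are tiny. At these coordinates the combination has, up to a small
    error, moduli at least sigma / 2 times those of [a], and averages do not depend on the
    positions. *)
Lemma dominates_lower {Y : completeNormedModType R} (x : nat -> @lorentz R L gam)
    (y : nat -> Y) (U : set_system nat) (UU : UltraFilter U) e (sigma : R) :
  \oo `<=` U -> weakly_null x -> generates x y -> 0 < sigma ->
  (\forall n \near U, sigma <= top_avg 0 (slice (x n) e)) ->
  dominates y (@unit_vec R L gam e).
Proof.
move=> ooU xw xy s0 xs.
apply: (@dominates_bnorm _ _ _ _ _ _ (2 / sigma)) => n a; apply: bnorm_le => K.
pose A := 1 + \sum_(i < n) `|a i|.
have A0 : 0 < A by rewrite ltr_pwDl// sumr_ge0.
suff main : sigma / 2 * level_sum gam e K (cutoff n a) <= `|\sum_(i < n) a i *: y i|.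
  by rewrite -ler_pdivrMl ?divr_gt0// invf_div.
apply/ler_addgt0Pr => eta eta0.
(* The first bound makes each peak belong to one vector only; the second keeps the errors [eta1 * A]
   at [K] levels below [eta / 2] in total. *)
pose eta1 := Num.min (sigma / 4) (eta / 2 / (A * K.+1%:R)).
have AK0 : 0 < A * K.+1%:R by rewrite mulr_gt0.
have eta1_gt0 : 0 < eta1 by rewrite lt_min !divr_gt0.
have eta1_s : eta1 < sigma / 2.
  by apply: (@le_lt_trans _ _ (sigma / 4)); [rewrite ge_min lexx|lra].
have eta1_A : K%:R * (eta1 * A) <= eta / 2.
  apply: (@le_trans _ _ (eta1 * (A * K.+1%:R))).
    by rewrite mulrC -mulrA ler_pM2l// ler_pM2l// ler_nat.
  by rewrite -ler_pdivlMr// ge_min lexx orbT.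
have [N hN] := generates_limit n a xy (divr_gt0 eta0 (ltr0Sn _ 1)).
pose P := [set m | (N <= m)%N /\ sigma <= top_avg 0 (slice (x m) e)].
pose Q i := [set j | (i < j)%N /\
  forall t, `|x i (e, t)| < eta1 \/ `|x j (e, t)| < eta1].
have UP : U P by apply: filterI => //; apply: ooU; exists N.
have UQ i : U (Q i).
  by apply: filterI; apply: ooU; [exists i.+1|exact: eventually_disjoint].
have [k [kP kQ]] := filter_increasing_choice UP UQ.
have peak i : {t | sigma / 2 < `|x (k i) (e, t)|}.
  apply: cid; apply: contrapT => /forallNP h.
  have [_ ] := kP i; rewrite leNgt => /negP; apply.
  apply: (@le_lt_trans _ _ (sigma / 2)); last by lra.
  by apply: top_avg_bound => t; rewrite leNgt; apply/negP; exact: h.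
pose t i := sval (peak i); have tP i : sigma / 2 < `|x (k i) (e, t i)| := svalP (peak i).
have off i j : i != j -> `|x (k j) (e, t i)| < eta1.
  have no (h : Prop) : `|x (k i) (e, t i)| < eta1 -> h.
    by move=> lt; have := lt_trans lt eta1_s; rewrite ltNge (ltW (tP _)).
  rewrite neq_ltn => /orP[ij|ji].
    by have [_ /(_ (t i))[lt|//]] := kQ _ _ ij; exact: no lt.
  by have [_ /(_ (t i))[//|lt]] := kQ _ _ ji; exact: no lt.
have t_inj i j : t i = t j -> i = j.
  move=> E; apply/eqP; apply: contraT => ij.
  have := off _ _ ij; rewrite E => /lt_trans/(_ eta1_s).
  by rewrite ltNge (ltW (tP _)).
pose s := \sum_(i < n) a i *: x (k i).
have sE i : (i < n)%N -> sigma / 2 * `|a i| <= `|slice s e (t i)| + eta1 * A.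
  move=> i_n; rewrite /slice /s lorentz_sumE (bigD1 (Ordinal i_n)) //=.
  set z := (X in `|_ + X|).
  have zA : `|z| <= eta1 * A.
    apply: le_trans (ler_norm_sum _ _ _) _.
    apply: (@le_trans _ _ (\sum_(j < n) eta1 * `|a j|)).
      rewrite [leLHS]big_mkcond /=; apply: ler_sum => j _; case: ifP => ij.
        rewrite normrM mulrC ler_wpM2r// ltW// off//.
        by apply: contra ij => /eqP E; apply/eqP/val_inj.
      by rewrite mulr_ge0// ltW.
    by rewrite -mulr_sumr ler_wpM2l ?ltW// /A ltrDr.
  have mainE : sigma / 2 * `|a i| <= `|a i * x (k i) (e, t i)|.
    by rewrite normrM mulrC ler_wpM2l// ltW.
  apply: le_trans mainE _; rewrite -lerBlDr.
  apply: le_trans (lerB_normD _ z); by rewrite lerD2l lerN2.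
have lev k' : sigma / 2 * top_avg k' (cutoff n a) <= top_avg k' (slice s e) + eta1 * A.
  have s2 : 0 <= sigma / 2 by rewrite divr_ge0// ltW.
  have := top_avgZ k' (sigma / 2) (cutoff_bound n a); rewrite (ger0_norm s2) => <-.
  have cn0 i : sigma / 2 * cutoff n a i != 0 -> (i < n)%N.
    by rewrite /cutoff; case: ifP; rewrite ?mulr0 ?eqxx.
  apply: (@top_avg_inj_err R k' _ (slice s e) `|s| (eta1 * A) t) => [|i|i /cn0 i_n|i j _ _].
  - by rewrite mulr_ge0// ltW.
  - exact: slice_bound.
  - by rewrite normrM (ger0_norm s2) /cutoff i_n; exact: sE.
  - exact: t_inj.
have sy : `|s| <= `|\sum_(i < n) a i *: y i| + eta / 2.
  have kmono i j : (i < j)%N -> (k i < k j)%N by move=> /kQ[].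
  have k0 : (N <= k 0)%N by case: (kP 0%N).
  by have /ltr_normlP[_] := hN k kmono k0; rewrite -/s; lra.
rewrite mulr_sumr.
apply: (@le_trans _ _ (level_sum gam e K (slice s e) + K%:R * (eta1 * A))).
  rewrite /level_sum big_mkcond [in leRHS]big_mkcond /=.
  rewrite -[X in X%:R * _]subn0 -[X in _ + X](_ : \sum_(0 <= k' < K) eta1 * A = _); last first.
    by rewrite sumr_const_nat mulr_natl.
  rewrite -big_split /=; apply: ler_sum => k' _; case: ifP => // _.
  by rewrite add0r mulr_ge0// ltW.
have := level_sum_le_norm e K s; lra.
Qed.

End Lower.

(** * Reduction to coefficients of constant modulus *)

Section SignVectors.
Context {R : realType} {L : choiceType} {gam : profile L}.
Implicit Types (e : L) (a : nat -> R).

Lemma uniq_extension (r B : seq nat) m : uniq r -> uniq B -> {subset r <= B} ->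
  (size r <= m <= size B)%N ->
  exists r', [/\ uniq r', {subset r <= r'}, {subset r' <= B} & size r' = m].
Proof.
move=> ur uB rB /andP[rm mB].
pose c := [seq t <- B | t \notin r].
have pB : perm_eq (r ++ c) B.
  apply: uniq_perm => //.
    rewrite cat_uniq ur filter_uniq// andbT; apply/hasPn => t.
    by rewrite mem_filter => /andP[].
  move=> t; rewrite mem_cat mem_filter; case tr: (t \in r) => //=.
  by rewrite rB.
have sc : size c = (size B - size r)%N by rewrite -(perm_size pB) size_cat addKn.
exists (r ++ take (m - size r) c); split.
- rewrite cat_uniq ur take_uniq ?filter_uniq// andbT.
  by apply/hasPn => t /mem_take; rewrite mem_filter => /andP[].
- by move=> t tr; rewrite mem_cat tr.
- by move=> t; rewrite mem_cat => /orP[/rB//|/mem_take]; rewrite mem_filter => /andP[].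
- rewrite size_cat size_take_min sc (minn_idPl _) ?subnKC//.
  by rewrite leq_sub2r.
Qed.

(** Lowering all nonzero moduli by [lam] keeps their order, so one selection is optimal for both
    summands: a selection for the remainder is enlarged inside the support to [m] indices, the
    number with which the sign vector reaches its average. *)
Lemma top_avg_layer k n a (lam : R) : 0 < lam ->
  (forall i, (i < n)%N -> a i != 0 -> lam <= `|a i|) ->
  lam * top_avg k (cutoff n (Num.sg \o a)) +
    top_avg k (cutoff n (fun i => a i - lam * Num.sg (a i))) <=
  top_avg k (cutoff n a).
Proof.
move=> lam0 lamB; set a' := fun i => _; pose m := minn (scale k) (size (supp n a)).
have absE i : i \in supp n a -> `|a i| = lam + `|a' i|.
  rewrite mem_supp => /andP[i_n ai]; have la := lamB i i_n ai.
  have -> : a' i = Num.sg (a i) * (`|a i| - lam).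
    by rewrite /a' {1}[a i]numEsg mulrBr [lam * _]mulrC.
  rewrite normrM normr_sg ai mul1r ger0_norm ?subr_ge0//.
  by rewrite addrC subrK.
have cut0 (b : nat -> R) (bz : forall i, a i = 0 -> b i = 0) t :
    t \notin supp n a -> cutoff n b t = 0.
  rewrite mem_supp negb_and negbK /cutoff; case: ifP => //= _ /eqP; exact: bz.
have sg_le : top_avg k (cutoff n (Num.sg \o a)) <= m%:R / (scale k)%:R.
  apply: top_avg_le => s /andP[us sk]; rewrite /sel_avg mulrC.
  rewrite ler_wpM2r ?invr_ge0 ?ler0n//.
  rewrite (bigID (mem (supp n a))) /= [X in _ + X]big1 ?addr0; last first.
    by move=> t ts; rewrite cut0 ?normr0// => i /= ->; rewrite sgr0.
  rewrite -big_filter; set r := [seq _ <- _ | _].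
  apply: (@le_trans _ _ (\sum_(t <- r) 1)).
    apply: ler_sum => t _; rewrite /cutoff; case: ifP => _; last by rewrite normr0.
    by rewrite /= normr_sg; case: (_ == _).
  rewrite big_const_seq count_predT iter_addr_0 ler_nat leq_min; apply/andP; split.
    by rewrite size_filter (leq_trans (count_size _ _)).
  by apply: uniq_leq_size; [exact: filter_uniq|move=> t; rewrite mem_filter => /andP[]].
apply: le_trans (lerD (ler_wpM2l (ltW lam0) sg_le) (lexx _)) _.
rewrite addrC -lerBrDr; apply: top_avg_le => s /andP[us sk].
rewrite lerBrDr.
pose r := [seq t <- s | t \in supp n a].
have rs : (size r <= m <= size (supp n a))%N.
  rewrite /m leq_min geq_minr andbT; apply/andP; split.
    by rewrite size_filter (leq_trans (count_size _ _)).
  by apply: uniq_leq_size; [exact: filter_uniq|move=> t; rewrite mem_filter => /andP[]].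
have [r' [ur' rr' r'B r'm]] : exists r', [/\ uniq r', {subset r <= r'},
    {subset r' <= supp n a} & size r' = m].
  apply: uniq_extension rs; [exact: filter_uniq|exact: supp_uniq|].
  by move=> t; rewrite mem_filter => /andP[].
have sel : selection k r' by rewrite /selection ur' r'm geq_minl.
apply: (le_trans _ (sel_avg_le_top (cutoff_bound n a) sel)).
rewrite /sel_avg mulrA [lam * _]mulrC -[X in _ + X]mulrC -mulrDr.
rewrite ler_wpM2l ?invr_ge0 ?ler0n//.
have -> : \sum_(t <- r') `|cutoff n a t| = \sum_(t <- r') (lam + `|cutoff n a' t|).
  apply: eq_big_seq => t /r'B tB; move: (tB).
  by rewrite mem_supp /cutoff => /andP[-> _]; exact: absE.
rewrite big_split /= big_const_seq count_predT iter_addr_0 r'm mulr_natl.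
rewrite [leLHS]addrC lerD2l.
rewrite (bigID (mem (supp n a))) /= [X in _ + X]big1 ?addr0; last first.
  by move=> t ts; rewrite cut0 ?normr0// => i /= ai0; rewrite /a' ai0 sgr0 mulr0 subr0.
rewrite -big_filter -/r; apply: sum_uniq_le => //; exact: filter_uniq.
Qed.

Lemma level_sum_mono e K K' a n : (K <= K')%N ->
  level_sum gam e K (cutoff n a) <= level_sum gam e K' (cutoff n a).
Proof.
move=> KK'; rewrite /level_sum !(big_mkcond (gam e)) /= [leRHS](big_cat_nat (n := K))//=.
rewrite lerDl sumr_ge0// => k _; case: ifP => // _.
exact: top_avg_ge0 (cutoff_bound n a).
Qed.

Lemma bnorm_layer e n a (lam : R) : 0 < lam ->
  (forall i, (i < n)%N -> a i != 0 -> lam <= `|a i|) ->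
  lam * bnorm gam e n (Num.sg \o a) +
    bnorm gam e n (fun i => a i - lam * Num.sg (a i)) <= bnorm gam e n a.
Proof.
move=> lam0 lamB; set a' := fun i => _.
(* Two independent truncation levels allow the two suprema to be taken one after the other. *)
have lev K K' : lam * level_sum gam e K (cutoff n (Num.sg \o a)) +
    level_sum gam e K' (cutoff n a') <= bnorm gam e n a.
  apply: (le_trans _ (level_sum_le_bnorm e n a (maxn K K'))).
  apply: (@le_trans _ _ (lam * level_sum gam e (maxn K K') (cutoff n (Num.sg \o a)) +
      level_sum gam e (maxn K K') (cutoff n a'))).
    apply: lerD; last by apply: level_sum_mono; exact: leq_maxr.
    by rewrite ler_pM2l//; apply: level_sum_mono; exact: leq_maxl.
  rewrite /level_sum mulr_sumr -big_split /=; apply: ler_sum => k _.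
  exact: top_avg_layer.
rewrite addrC -lerBrDr; apply: bnorm_le => K'; rewrite lerBrDr addrC -lerBrDr.
rewrite -ler_pdivlMl//; apply: bnorm_le => K; rewrite ler_pdivlMl// lerBrDr.
exact: lev.
Qed.

(* Peeling off layers of constant modulus writes a vector as a positive
   combination of sign vectors on which [bnorm] is additive. *)
Lemma bnorm_from_signs {X : normedModType R} (z : nat -> X) e n (C : R) : 0 <= C ->
  (forall a, (forall i, `|a i| = (a i != 0)%:R) ->
    `|\sum_(i < n) a i *: z i| <= C * bnorm gam e n a) ->
  forall a, `|\sum_(i < n) a i *: z i| <= C * bnorm gam e n a.
Proof.
move=> C0 signs a; have [m] := ubnP (size (supp n a)).
elim: m a => // m IH a am.
have [sa|[i0 i0B]] : supp n a = [::] \/ exists i, i \in supp n a.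
  by case: (supp n a) => [|i l]; [left|right; exists i; rewrite mem_head].
  rewrite big1 ?normr0 ?mulr_ge0//; first exact: normr_ge0.
  move=> i _; have : val i \notin supp n a by rewrite sa.
  by rewrite mem_supp ltn_ord /= negbK => /eqP->; rewrite scale0r.
have [i0n ai0] : (i0 < n)%N /\ a i0 != 0 by move: i0B; rewrite mem_supp => /andP[].
pose i1 := [arg min_(i < Ordinal i0n | a i != 0) `|a i|]%O.
have [i1B i1min] : a i1 != 0 /\ forall i : 'I_n, a i != 0 -> `|a i1| <= `|a i|.
  by rewrite /i1; case: Order.TotalTheory.arg_minP.
pose lam := `|a i1|; have lam0 : 0 < lam by rewrite normr_gt0.
have lamB i : (i < n)%N -> a i != 0 -> lam <= `|a i|.
  by move=> i_n; exact: (i1min (Ordinal i_n)).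
apply: (@le_trans _ _ (C * (lam * bnorm gam e n (Num.sg \o a) +
    bnorm gam e n (fun i => a i - lam * Num.sg (a i))))); last first.
  by rewrite ler_wpM2l// bnorm_layer.
have -> : \sum_(i < n) a i *: z i = lam *: \sum_(i < n) (Num.sg \o a) i *: z i +
    \sum_(i < n) (a i - lam * Num.sg (a i)) *: z i.
  rewrite scaler_sumr -big_split /=; apply: eq_bigr => i _.
  by rewrite scalerA -scalerDl addrC subrK.
apply: le_trans (ler_normD _ _) _; rewrite mulrDr; apply: lerD.
  rewrite normrZ gtr0_norm// mulrCA ler_pM2l//; apply: signs => i /=.
  by rewrite normr_sg sgr_eq0.
apply: IH; rewrite -ltnS; apply: leq_trans am; rewrite ltnS.
set a' := fun i => _.
apply: (@leq_trans (size (rem (val i1) (supp n a))).+1); last first.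
  have i1s : val i1 \in supp n a by rewrite mem_supp ltn_ord.
  by rewrite size_rem// prednK// -has_predT; apply/hasP; exists (val i1).
rewrite ltnS; apply: uniq_leq_size; first exact: supp_uniq.
move=> i; rewrite (mem_rem_uniq _ (supp_uniq n a)) inE /= !mem_supp => /andP[i_n a'i].
have ai : a i != 0.
  by apply: contra a'i => /eqP E; rewrite /a' E sgr0 mulr0 subr0.
rewrite i_n ai !andbT; apply: contra a'i => /eqP ->.
by rewrite /a' /lam mulrC mulr_sg_norm subrr.
Qed.

End SignVectors.

(** If 0 = k_0 < k_1 < ... enumerates [g], then k_(i-1) <= k_i - 1, so [al] at k_i - 1 is at most
    [al] at k_(i-1). In the induction, the term with [~~ g K] stands for the last element of [g]
    before [K], still unmatched. *)
Lemma sum_shift_le {R : realType} (g : nat -> bool) (al : nat -> R) K : g 0%N ->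
  (forall k, 0 <= al k) -> (forall k, al k.+1 <= al k) ->
  \sum_(0 <= k < K) (g k.+1)%:R * al k <= \sum_(0 <= k < K) (g k)%:R * al k.
Proof.
move=> g0 al0 aldecr.
suff : \sum_(0 <= k < K) (g k.+1)%:R * al k + (~~ g K)%:R * al K <=
    \sum_(0 <= k < K) (g k)%:R * al k.
  by apply: le_trans; rewrite lerDl mulr_ge0.
elim: K => [|K IH]; first by rewrite !big_geq// g0 mul0r addr0.
rewrite !big_nat_recr //=; move: IH (al0 K) (al0 K.+1) (aldecr K).
set S := \sum_(_ <= _ < _) _; set T := \sum_(_ <= _ < _) _.
by case: (g K); case: (g K.+1) => /=; rewrite ?mul1r ?mul0r ?addr0; lra.
Qed.

(** * Upper estimates for spreading models *)

Section Upper.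
Context {R : realType} {L : choiceType} {gam : profile L}.
Implicit Types (v w : @lorentz R L gam) (F G : seq (L * nat)) (e : L).

Lemma top_sum_scale G c v : top_sum G (c *: v) = `|c| * top_sum G v.
Proof.
rewrite /top_sum mulr_sumr; apply: eq_bigr => p _.
exact: (top_avgZ _ _ (slice_bound v p.1)).
Qed.

Lemma top_sum_comb G n (a : nat -> R) (z : nat -> @lorentz R L gam) :
  top_sum G (\sum_(i < n) a i *: z i) <= \sum_(i < n) `|a i| * top_sum G (z i).
Proof.
elim: n => [|n IH]; first by rewrite !big_ord0 -(scale0r 0) top_sum_scale normr0 mul0r.
rewrite !big_ord_recr /= -top_sum_scale; apply: (le_trans _ (lerD IH (lexx _))).
set u := \sum_(i < n) _; set w := _ *: _.
rewrite /top_sum -big_split /=; apply: ler_sum => p _.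
exact: top_avgD (slice_bound u p.1) (slice_bound w p.1).
Qed.

Lemma norm_le_top_sum F v (d : R) : active gam F ->
  (forall G, active gam G -> {in G, forall p, p \notin F} -> top_sum G v <= d) ->
  `|v| <= top_sum F v + d.
Proof.
move=> /andP[uF aF] h; apply: norm_le_sum_top => G /andP[uG aG].
rewrite (bigID (mem F)) /=; apply: lerD; rewrite -big_filter.
  apply: sum_uniq_le => //; first exact: filter_uniq.
    by move=> p; rewrite mem_filter => /andP[].
  by move=> p; exact: top_avg_slice_ge0.
apply: h; last by move=> p; rewrite mem_filter => /andP[].
rewrite /active filter_uniq//=; apply/allP => p; rewrite mem_filter => /andP[_ pG].
by move/allP: aG; apply.
Qed.

(** Finite sets of pairs are enlarged to rectangles so that sums over them split into level sums. *)
Definition rect (E : seq L) K : seq (L * nat) :=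
  [seq p <- [seq (e, k) | e <- E, k <- index_iota 0 K] | gam p.1 p.2].

Lemma mem_rect E K e k : ((e, k) \in rect E K) = [&& gam e k, e \in E & (k < K)%N].
Proof.
rewrite mem_filter /=; congr (_ && _); apply/allpairsP/andP => [[[e' k'] /=]|[eE kK]].
  by rewrite mem_index_iota => -[h1 h2 [-> ->]].
by exists (e, k); rewrite mem_index_iota.
Qed.

Lemma rect_active E K : uniq E -> active gam (rect E K).
Proof.
move=> uE; rewrite /active filter_all andbT filter_uniq//.
by apply: allpairs_uniq; rewrite ?iota_uniq// => -[e k] [e' k'] _ _ [-> ->].
Qed.

Lemma top_sum_rect E K v : top_sum (rect E K) v = \sum_(e <- E) level_sum gam e K (slice v e).
Proof.
rewrite /top_sum /rect big_filter big_mkcond big_allpairs /=.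
by apply: eq_bigr => e _; rewrite /level_sum [RHS]big_mkcond.
Qed.

Lemma filter_seq_forall (U : set_system nat) {UF : Filter U} {T : eqType} (l : seq T)
    (P : T -> set nat) :
  (forall i, i \in l -> U (P i)) -> U [set n | forall i, i \in l -> P i n].
Proof.
elim: l => [|i l IH] h; first by apply: nearW.
have h1 : U (P i) by apply: h; rewrite mem_head.
have h2 : U [set n | forall i, i \in l -> P i n].
  by apply: IH => j jl; apply: h; rewrite inE jl orbT.
apply: filterS (filterI h1 h2) => n [Pi Pl] j.
by rewrite inE => /predU1P[->//|]; exact: Pl.
Qed.

(* [own t] is the only index whose vector may be large at coordinate [t]. *)
Lemma near_disjoint_owner n (a : nat -> R) (z : nat -> @lorentz R L gam) e (eta : R) (i0 : 'I_n) :
  0 < eta -> a i0 != 0 -> (forall i, `|a i| = (a i != 0)%:R) ->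
  (forall i j, (i < j)%N -> forall t, `|z i (e, t)| < eta \/ `|z j (e, t)| < eta) ->
  exists own : nat -> 'I_n, (forall t, a (own t) != 0) /\
    forall t, `|slice (\sum_(i < n) a i *: z i) e t| <= `|z (own t) (e, t)| + n%:R * eta.
Proof.
move=> eta0 ai0 a1 dis.
have own t : {j : 'I_n | a j != 0 /\
    `|slice (\sum_(i < n) a i *: z i) e t| <= `|z j (e, t)| + n%:R * eta}.
  apply: cid.
  have sumE : slice (\sum_(i < n) a i *: z i) e t = \sum_(i < n) a i * z i (e, t).
    by rewrite /slice lorentz_sumE.
  have aE (i : 'I_n) : `|a i * z i (e, t)| = (a i != 0)%:R * `|z i (e, t)|.
    by rewrite normrM a1.
  have rest (Q : pred 'I_n) : (forall i, Q i -> a i != 0 -> `|z i (e, t)| < eta) ->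
      `|\sum_(i < n | Q i) a i * z i (e, t)| <= n%:R * eta.
    move=> small; apply: le_trans (ler_norm_sum _ _ _) _.
    rewrite -[leRHS](_ : \sum_(i < n) eta = _); last first.
      by rewrite big_const_ord iter_addr_0 mulr_natl.
    rewrite big_mkcond /=; apply: ler_sum => i _; case: ifP => Qi; last exact: ltW.
    rewrite aE; case: eqP => [_|/eqP ai]; first by rewrite mul0r ltW.
    by rewrite mul1r ltW// small.
  have [[j [aj zj]]|none] := pselect (exists j : 'I_n, a j != 0 /\ eta <= `|z j (e, t)|).
    exists j; split=> //; rewrite sumE (bigD1 j)//=.
    apply: le_trans (ler_normD _ _) _; apply: lerD.
      by rewrite aE aj mul1r.
    apply: rest => i ij ai; move: ij; rewrite -(inj_eq val_inj) /= neq_ltn => /orP[lt|lt].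
      by have [//|] := dis _ _ lt t; rewrite ltNge zj.
    by have [|//] := dis _ _ lt t; rewrite ltNge zj.
  exists i0; split=> //; rewrite sumE; apply: le_trans (rest xpredT _) _.
    by move=> i _ ai; rewrite ltNge; apply/negP => h; apply: none; exists i.
  by rewrite lerDr.
exists (fun t => sval (own t)); split => t; by have [] := svalP (own t).
Qed.

Lemma top_avg_near_disjoint n (a : nat -> R) (z : nat -> @lorentz R L gam) e (eta b : R) k :
  0 < eta -> 0 <= b -> (forall i, `|a i| = (a i != 0)%:R) ->
  (forall i j, (i < j)%N -> forall t, `|z i (e, t)| < eta \/ `|z j (e, t)| < eta) ->
  (forall i, (i < n)%N -> top_avg 0 (slice (z i) e) <= b) ->
  top_avg k (slice (\sum_(i < n) a i *: z i) e) <= b + n%:R * eta.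
Proof.
move=> eta0 b0 a1 dis zb.
have bn0 : 0 <= b + n%:R * eta by rewrite addr_ge0// mulr_ge0// ltW.
have [[i0 ai0]|none] := pselect (exists i : 'I_n, a i != 0); last first.
  rewrite big1 => [|i _]; last first.
    by apply/eqP; rewrite scaler_eq0; apply/orP; left; apply/negPn/negP => h; apply: none; exists i.
  by apply: top_avg_bound => t; rewrite /slice /= normr0.
have [own [_ ownP]] := near_disjoint_owner eta0 ai0 a1 dis.
apply: top_avg_bound => t; apply: le_trans (ownP t) _; rewrite lerD2r.
apply: (le_trans _ (zb _ (ltn_ord (own t)))).
exact: coord_le_top0 (slice_bound (z (own t)) e).
Qed.

(** A selection at scale [k.+1] is split by owner and each part cut into chunks of size [scale k].
    At most one chunk per piece is incomplete; rounding these up adds at most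
    [scale k ^ 2 <= scale k.+1] indices in all, whence the factor 2. *)
Lemma top_avg_near_disjoint_spread n (a : nat -> R) (z : nat -> @lorentz R L gam) e
    (eta b : R) k :
  0 < eta -> 0 <= b -> (forall i, `|a i| = (a i != 0)%:R) ->
  (forall i j, (i < j)%N -> forall t, `|z i (e, t)| < eta \/ `|z j (e, t)| < eta) ->
  (forall i, (i < n)%N -> top_avg k (slice (z i) e) <= b) ->
  (size (supp n a) <= scale k)%N ->
  top_avg k.+1 (slice (\sum_(i < n) a i *: z i) e) <= 2 * b + n%:R * eta.
Proof.
move=> eta0 b0 a1 dis zb sm.
have bn0 : 0 <= 2 * b + n%:R * eta.
  by rewrite addr_ge0// mulr_ge0// ltW.
have [[i0 ai0]|none] := pselect (exists i : 'I_n, a i != 0); last first.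
  rewrite big1 => [|i _]; last first.
    by apply/eqP; rewrite scaler_eq0; apply/orP; left; apply/negPn/negP => h; apply: none; exists i.
  by apply: top_avg_bound => t; rewrite /slice /= normr0.
have [own [own0 ownP]] := near_disjoint_owner eta0 ai0 a1 dis.
apply: top_avg_le => r /andP[ur rk]; rewrite /sel_avg ler_pdivrMl ?scaleR_gt0//.
apply: (@le_trans _ _ (\sum_(t <- r) (`|z (own t) (e, t)| + n%:R * eta))).
  by apply: ler_sum => t _; exact: ownP.
rewrite big_split /= mulrDr; apply: lerD; last first.
  rewrite big_const_seq count_predT iter_addr_0 -[leLHS]mulr_natl ler_wpM2r ?ler_nat//.
  by rewrite mulr_ge0// ltW.
pose part i := [seq t <- r | own t == i].
have parts (f : nat -> R) : \sum_(t <- r) f t =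
    \sum_(i < n | a i != 0) \sum_(t <- part i) f t.
  rewrite (partition_big own (fun i : 'I_n => a i != 0)) //=.
  by apply: eq_bigr => i _; rewrite big_filter.
have sizes : (\sum_(i < n | a i != 0%R) size (part i) = size r)%N.
  rewrite -sum1_size [RHS](partition_big own (fun i : 'I_n => a i != 0)) //=.
  by apply: eq_bigr => i _; rewrite -sum1_size big_filter.
pose c i := (size (part i) %/ scale k).+1.
rewrite parts; apply: (@le_trans _ _
    (\sum_(i < n | a i != 0) (c i)%:R * (scale k)%:R * b)).
  apply: ler_sum => i ai.
  apply: (@le_trans _ _ (\sum_(t <- part i) `|slice (z i) e t|)).
    rewrite big_seq [leRHS]big_seq; apply: ler_sum => t.
    by rewrite mem_filter => /andP[/eqP-> _].
  apply: le_trans (sum_le_top_avg (k := k) (c := c i) (slice_bound (z i) e) _ _) _.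
  - exact: filter_uniq.
  - by apply: ltnW; rewrite /c ltn_ceil ?scale_gt0.
  - by apply: ler_wpM2l; [rewrite mulr_ge0|exact: zb].
rewrite -!mulr_suml mulrA ler_wpM2r// -natr_sum -!natrM ler_nat big_distrl /=.
apply: (@leq_trans (\sum_(i < n | a i != 0%R) (size (part i) + scale k))).
  by apply: leq_sum => i _; rewrite mulSn addnC leq_add2r leq_trunc_div.
rewrite big_split /= sizes sum_nat_cond_const muln2 -addnn; apply: leq_add => //.
rewrite (_ : #|_| = size (supp n a)); last first.
  rewrite /supp size_filter -sum1_card -sum1_count big_mkcond [RHS]big_mkcond /=.
  have -> : iota 0 n = index_iota 0 n by rewrite /index_iota subn0.
  by rewrite big_mkord; apply: eq_bigr => i _; rewrite inE.
by apply: (leq_trans _ (scale_square k)); rewrite -mulnn leq_mul2r sm orbT.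
Qed.

End Upper.

Arguments rect {L} gam E K.

Section UpperDomination.
Context {R : realType} {L : choiceType} {gam : profile L}.
Implicit Types (e g : L) (G : seq (L * nat)).
Variables (x : nat -> @lorentz R L gam) (xw : weakly_null x) (x1 : normalized x).
Variables (U : set_system nat) (UU : UltraFilter U) (ooU : \oo `<=` U).

(** As [scale 0] is 1, [lim_avg e 0] is the limiting sup norm of the [e]-components. *)
Definition lim_avg e k : R := ulim U (fun m => top_avg k (slice (x m) e)).

Lemma lim_avgP e k : top_avg k (slice (x m) e) @[m --> U] --> lim_avg e k.
Proof.
apply: (@ulimP _ _ _ _ 1) => m; rewrite ger0_norm ?top_avg_slice_ge0//.
by apply: top_avg_bound => t; rewrite -(x1 m) slice_bound.
Qed.

Lemma lim_avg_ge0 e k : 0 <= lim_avg e k.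
Proof.
by apply: (cvgr_to_ge (@lim_avgP e k)); apply: nearW => m; exact: top_avg_slice_ge0.
Qed.

Lemma lim_avg_decr e k : lim_avg e k.+1 <= lim_avg e k.
Proof.
apply: (ler_cvg_to (@lim_avgP e k.+1) (@lim_avgP e k)); apply: nearW => m.
exact: top_avg_decr (slice_bound (x m) e).
Qed.

Lemma sum_lim_avg G : active gam G -> \sum_(p <- G) lim_avg p.1 p.2 <= 1.
Proof.
move=> aG.
have h : top_sum G (x m) @[m --> U] --> \sum_(p <- G) lim_avg p.1 p.2.
  by apply: cvg_big => [|p _]; [exact: add_continuous|exact: lim_avgP].
by apply: (cvgr_to_le h); apply: nearW => m; rewrite -(x1 m); exact: sum_top_le_norm.
Qed.

Lemma count_scales_restrict e g K J : (forall k, gam e k -> gam g k) ->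
  (\sum_(0 <= k < K | gam e k) (k <= J) <= count_scales gam g J.+1)%N.
Proof.
move=> eg; rewrite /count_scales (big_nat_widen 0 J.+1 (maxn K J.+1)) ?leq_maxr//=.
apply: (@leq_trans (\sum_(0 <= k < maxn K J.+1 | gam e k) (k <= J))).
  by rewrite [leqRHS](big_cat_nat (n := K)) ?leq_maxl//= leq_addr.
rewrite big_mkcond [leqRHS]big_mkcond /=; apply: leq_sum => k _.
rewrite ltnS; case: (leqP k J) => _; last by case: ifP.
by case: ifP => // /eg ->.
Qed.

(** Beyond [J] the spread bound refers to the preceding scale [k.-1], which [e] need not use;
    [sum_shift_le] moves the sum back to scales of [e]. *)
Lemma upper_level_sum e g K J : 0 < lim_avg e 0 -> (forall k, gam e k -> gam g k) ->
  \sum_(0 <= k < K | gam e k)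
    (if (k <= J)%N then lim_avg e 0 else 2 * lim_avg e k.-1) <=
  lim_avg e 0 * (count_scales gam g J.+1)%:R +
    2 * \sum_(0 <= k < K | gam e k) lim_avg e k.
Proof.
move=> e0 eg.
apply: (@le_trans _ _ (lim_avg e 0 * (\sum_(0 <= k < K | gam e k) (k <= J))%:R +
   2 * \sum_(0 <= k < K) (gam e k && (0 < k)%N)%:R * lim_avg e k.-1)).
  rewrite natr_sum !mulr_sumr [in leRHS]big_mkcond -big_split [leLHS]big_mkcond /=.
  apply: ler_sum => k _; case: (gam e k) => /=; last by rewrite mul0r mulr0 addr0.
  case: (leqP k J) => kJ.
    by rewrite mulr1 lerDl !mulr_ge0// lim_avg_ge0.
  by rewrite mulr0 add0r (leq_ltn_trans _ kJ)// mul1r.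
apply: lerD.
  by rewrite ler_pM2l// ler_nat count_scales_restrict.
rewrite ler_pM2l//; case: K => [|K]; first by rewrite !big_geq.
rewrite big_nat_recl// andbF mul0r add0r.
under eq_bigr do rewrite andbT.
apply: le_trans (sum_shift_le _ (scales0 gam e) (lim_avg_ge0 e) (lim_avg_decr e)) _.
rewrite [leRHS]big_mkcond /= big_nat_recr//= -[leLHS]addr0; apply: lerD.
  by apply: ler_sum => k _; case: ifP; rewrite ?mul1r ?mul0r.
by case: ifP => //; rewrite lim_avg_ge0.
Qed.

(** One [h] must serve all sign vectors of length [n], since the layers of a combination have
    different signs and supports. With c the number of scales of [g] below [J], the rectangle
    contributes at most (c + 1) + 3 and the other pairs at most 1; as c and 1 are both at most
    [bnorm gam g n a], the constant 6 suffices. *)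
Lemma far_sign_sums g n N : (forall e, 0 < lim_avg e 0 -> forall k, gam e k -> gam g k) ->
  exists h : nat -> nat,
    [/\ forall i j, (i < j)%N -> (h i < h j)%N, (N <= h 0)%N &
    forall a : nat -> R, (forall i, `|a i| = (a i != 0)%:R) ->
      `|\sum_(i < n) a i *: x (h i)| <= 6 * bnorm gam g n a].
Proof.
move=> upper.
(* With tails of size 1 / (n + 1), the [n] vectors together contribute at most 1 outside the
   rectangle. *)
have [F [N0 tail]] := weakly_null_tail xw (ltac:(by rewrite invr_gt0) : 0 < (n.+1%:R : R)^-1).
pose E := undup (map fst F); pose K := (\max_(p <- F) p.2).+1.
have FE p : p \in F -> p.1 \in E /\ (p.2 < K)%N.
  move=> pF; split; first by rewrite mem_undup map_f.
  by rewrite ltnS; exact: (@leq_bigmax_seq _ F xpredT (fun p : L * nat => p.2) p).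
(* Each of the at most [size E * K] averages carries an error [(n + 2) * eta]; this choice keeps
   their sum below 1. *)
pose D : R := (size E * K * (n + 2)).+1%:R; pose eta := D^-1.
have eta0 : 0 < eta by rewrite invr_gt0.
pose box := [seq (e, k) | e <- E, k <- index_iota 0 K].
have boxP e k : e \in E -> (k < K)%N -> (e, k) \in box.
  by move=> eE kK; apply/allpairsP; exists (e, k); rewrite mem_index_iota.
pose P := [set m | [/\ (maxn N N0 <= m)%N &
  forall p, p \in box -> top_avg p.2 (slice (x m) p.1) <= lim_avg p.1 p.2 + eta]].
pose Q i := [set j | (i < j)%N /\ forall e, e \in E ->
  forall t, `|x i (e, t)| < eta \/ `|x j (e, t)| < eta].
have UP : U P.
  have h1 : U [set m | (maxn N N0 <= m)%N] by apply: ooU; exists (maxn N N0).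
  have h2 := @filter_seq_forall U _ _ box (fun p =>
    [set m | top_avg p.2 (slice (x m) p.1) <= lim_avg p.1 p.2 + eta]).
  have {}h2 : U [set m | forall p, p \in box ->
      top_avg p.2 (slice (x m) p.1) <= lim_avg p.1 p.2 + eta].
    apply: h2 => p _.
    have lt : lim_avg p.1 p.2 < lim_avg p.1 p.2 + eta by rewrite ltrDl.
    exact: (cvgr_le _ (@lim_avgP p.1 p.2) _ lt).
  by apply: filterS (filterI h1 h2) => m [].
have UQ i : U (Q i).
  apply: filterI; first by apply: ooU; exists i.+1.
  have := @filter_seq_forall U _ _ E (fun e =>
    [set j | forall t, `|x i (e, t)| < eta \/ `|x j (e, t)| < eta]).
  by apply => e _; apply: ooU; exact: eventually_disjoint.
have [h [hP hQ]] := filter_increasing_choice UP UQ.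
exists h; split.
- by move=> i j /hQ[].
- by have [] := hP 0%N; rewrite geq_max => /andP[].
move=> a a1; set s := \sum_(i < n) _.
have [m0|m_gt0] := posnP (size (supp n a)).
  have -> : s = 0.
    rewrite /s big1// => i _; have : val i \notin supp n a by rewrite (size0nil m0).
    by rewrite mem_supp ltn_ord /= negbK => /eqP->; rewrite scale0r.
  by rewrite normr0 mulr_ge0//; exact: normr_ge0.
have exJ : exists J, (size (supp n a) <= scale J)%N.
  by exists (size (supp n a)); apply: ltnW; exact: scale_gt_id.
(* By minimality every scale before [J] is smaller than the support, so [count_scales_le_bnorm]
   applies with this [J]. *)
case: (ex_minnP exJ) => J mJ Jmin.
have avg_le e k i : e \in E -> (k < K)%N -> top_avg k (slice (x (h i)) e) <= lim_avg e k + eta.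
  by move=> eE kK; have [_ /(_ _ (boxP _ _ eE kK))] := hP i.
have dis e : e \in E -> forall i j, (i < j)%N ->
    forall t, `|x (h i) (e, t)| < eta \/ `|x (h j) (e, t)| < eta.
  by move=> eE i j /hQ[_ /(_ e eE)].
(* Elements with vanishing limiting sup norm get the bound 0: their scales need not be scales of
   [g], and only the error term remains. *)
pose bd e k := if 0 < lim_avg e 0 then
  (if (k <= J)%N then lim_avg e 0 else 2 * lim_avg e k.-1) else 0.
have avg_s e k : e \in E -> (k < K)%N ->
    top_avg k (slice s e) <= bd e k + (n + 2)%:R * eta.
  move=> eE kK; have b0 k' : 0 <= lim_avg e k' + eta by rewrite addr_ge0 ?lim_avg_ge0// ltW.
  have h0 : top_avg k (slice s e) <= lim_avg e 0 + (n + 2)%:R * eta.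
    apply: le_trans (top_avg_near_disjoint k eta0 (b0 0%N) a1 (dis e eE) _) _.
      by move=> i _; apply: avg_le.
    by rewrite natrD; lra.
  rewrite /bd; case: ltP => [_|al0]; last first.
    by apply: le_trans h0 _; rewrite lerD2r.
  case: leqP => // Jk; case: k kK Jk {h0} => // k kK Jk.
  apply: le_trans (top_avg_near_disjoint_spread eta0 (b0 k) a1 (dis e eE) _ _) _.
  - by move=> i _; apply: avg_le => //; exact: ltnW.
  - by apply: leq_trans mJ _; exact: scale_le.
  - by rewrite natrD /=; lra.
have aR : active gam (rect gam E K) by apply: rect_active; exact: undup_uniq.
have sum0 : \sum_(e <- E) lim_avg e 0 <= 1.
  have aE : active gam [seq (e, 0%N) | e <- E].
    rewrite /active map_inj_uniq ?undup_uniq => [|e e' []//].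
    by apply/allP => p /mapP[e _ ->]; exact: scales0.
  by have := sum_lim_avg aE; rewrite big_map.
have sumR : \sum_(e <- E) \sum_(0 <= k < K | gam e k) lim_avg e k <= 1.
  have := sum_lim_avg aR; rewrite /rect big_filter big_mkcond big_allpairs /=.
  by under eq_bigr do rewrite -big_mkcond.
have main : top_sum (rect gam E K) s <= (count_scales gam g J.+1)%:R + 3.
  rewrite top_sum_rect.
  apply: (@le_trans _ _ (\sum_(e <- E) (lim_avg e 0 * (count_scales gam g J.+1)%:R +
      2 * (\sum_(0 <= k < K | gam e k) lim_avg e k) + K%:R * ((n + 2)%:R * eta)))).
    rewrite big_seq [leRHS]big_seq; apply: ler_sum => e eE.
    apply: (@le_trans _ _ (\sum_(0 <= k < K | gam e k) (bd e k + (n + 2)%:R * eta))).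
      rewrite /level_sum big_nat_cond [leRHS]big_nat_cond.
      by apply: ler_sum => k /andP[/andP[_ kK] _]; exact: avg_s.
    rewrite big_split /=; apply: lerD.
      rewrite /bd; case: ltP => [al0|_]; first exact: upper_level_sum (upper e al0).
      rewrite big1// addr_ge0// ?mulr_ge0 ?lim_avg_ge0// sumr_ge0// => k _.
      exact: lim_avg_ge0.
    rewrite big_mkcond /=.
    apply: (@le_trans _ _ (\sum_(0 <= k < K) (n + 2)%:R * eta)).
      by apply: ler_sum => k _; case: ifP => // _; rewrite mulr_ge0// ltW.
    by rewrite sumr_const_nat subn0 [leRHS]mulr_natl.
  rewrite !big_split /= -mulr_suml -mulr_sumr.
  rewrite big_const_seq count_predT iter_addr_0.
  have err : (K%:R * ((n + 2)%:R * eta)) *+ size E <= 1.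
    rewrite -mulr_natl !mulrA -!natrM /eta ler_pdivrMr ?ltr0n// mul1r /D ler_nat.
    exact: leqnSn.
  have c0 : 0 <= (count_scales gam g J.+1)%:R :> R by exact: ler0n.
  have := ler_wpM2r c0 sum0; rewrite mul1r; lra.
have rest G : active gam G -> {in G, forall p, p \notin rect gam E K} -> top_sum G s <= 1.
  move=> aG GR; apply: le_trans (@top_sum_comb _ _ _ G n a (fun i => x (h i))) _.
  apply: (@le_trans _ _ (\sum_(i < n) (n.+1%:R^-1 : R))).
    apply: ler_sum => i _; rewrite a1.
    have tG : top_sum G (x (h i)) <= n.+1%:R^-1.
      apply: tail => //; first by have [] := hP i; rewrite geq_max => /andP[].
      move=> [e k] pG; apply: contra (GR _ pG) => /FE[/= eE kK].
      rewrite mem_rect eE kK !andbT.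
      by case/andP: aG => _ /allP/(_ _ pG).
    by case: (a i != 0); rewrite ?mul1r// mul0r invr_ge0.
  rewrite big_const_ord iter_addr_0 -[leLHS]mulr_natl ler_pdivrMr// mul1r ler_nat.
  exact: leqnSn.
have := norm_le_top_sum aR rest.
have cJ : (count_scales gam g J)%:R <= bnorm gam g n a.
  apply: count_scales_le_bnorm => // k kJ; rewrite ltnW// ltnNge.
  by apply/negP => /Jmin; rewrite leqNgt kJ.
have c1 : 1 <= bnorm gam g n a.
  have := @count_scales_le_bnorm R L gam g n 1 a a1 _.
  rewrite {1}/count_scales big_nat1 scales0; apply.
  by move=> [|//] _; rewrite scale0.
have cS : (count_scales gam g J.+1)%:R <= (count_scales gam g J)%:R + 1 :> R.
  by rewrite natr1 ler_nat /count_scales big_nat_recr//= -addn1 leq_add2l leq_b1.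
lra.
Qed.

Lemma dominates_upper {Y : completeNormedModType R} (y : nat -> Y) g :
  generates x y -> (forall e, 0 < lim_avg e 0 -> forall k, gam e k -> gam g k) ->
  dominates (@unit_vec R L gam g) y.
Proof.
move=> xy upper; exists (6 * delta_norm gam g) => n a.
rewrite -mulrA -bnorm_le_unit_vec; apply/ler_addgt0Pr => eta eta0.
have [N hN] := generates_limit n a xy eta0.
have [h [hmono h0 signs]] := far_sign_sums n N upper.
have /ltr_normlP[lt _] := hN h hmono h0.
have := bnorm_from_signs (z := fun i => x (h i)) (ltac:(by []) : (0:R) <= 6) signs a.
by move: lt; rewrite opprB; lra.
Qed.

End UpperDomination.

(** * Scales attached to the elements of a semilattice *)

Section Profile.
Context {d : Order.disp_t} {L : joinSemilatticeType d}.
Variables (code : L -> nat) (code_inj : injective code).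
Implicit Types (e f : L) (t k : nat).

(** Block [t] is the interval from t! - 1 to (t + 1)! - 2: it has t * t! elements, against t! - 1
    smaller numbers. *)
Definition block t k : bool := (t`! <= k.+1 < t.+1`!)%N.

(* Every label is attained on infinitely many [t]. *)
Definition label t : nat := logn 2 t.

(* The block [t] is skipped by [e] exactly when its label is the code of an
   element above [e]; label 0 codes nothing, so every [e] uses infinitely many
   blocks. *)
Definition skipped e t : Prop := exists f, (code f).+1 = label t /\ (e <= f)%O.

Definition uses e k : bool := `[< exists t, block t k /\ ~ skipped e t >].

Lemma label_pow n m : label (2 ^ n * m.*2.+1) = n.
Proof.
rewrite /label lognM ?expn_gt0// pfactorK// logn_coprime ?addn0//.
by rewrite coprime2n /= odd_double.
Qed.

Lemma fact_mono m n : (m <= n)%N -> (m`! <= n`!)%N.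
Proof.
move=> /subnK <-; elim: (n - m)%N => // i IH.
by rewrite addSn factS (leq_trans IH)// leq_pmull.
Qed.

Lemma block_uniq t t' k : block t k -> block t' k -> t = t'.
Proof.
move=> /andP[h1 h2] /andP[h3 h4]; case: (ltngtP t t') => // tt'.
- by have := leq_trans h2 (leq_trans (fact_mono tt') h3); rewrite ltnn.
- by have := leq_trans h4 (leq_trans (fact_mono tt') h1); rewrite ltnn.
Qed.

Lemma uses0 e : uses e 0.
Proof.
apply/asboolP; exists 1%N; split=> // -[f []].
by rewrite /label logn1.
Qed.

Lemma uses_unbounded e K : exists2 k, (K <= k)%N & uses e k.
Proof.
pose t := K.*2.+1; exists t`!.-1.
  have := fact_geq t; rewrite /t; move: (_ `!) => m; rewrite -addnn; lia.
apply/asboolP; exists t; split.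
  rewrite /block prednK ?fact_gt0// leqnn /= factS -[X in (X < _)%N]mul1n.
  by rewrite ltn_mul2r fact_gt0 ltnS.
by move=> [f []]; rewrite -[t]mul1n -[1%N](expn0 2) label_pow.
Qed.

Definition order_profile : profile L := Profile uses0 uses_unbounded.

Lemma uses_mono e e' k : (e <= e')%O -> uses e k -> uses e' k.
Proof.
move=> ee' /asboolP[t [bt nt]]; apply/asboolP; exists t; split=> // -[f [ft e'f]].
by apply: nt; exists f; split=> //; exact: Order.le_trans e'f.
Qed.

Lemma uses_join e e' k : uses (e `|` e')%O k -> uses e k || uses e' k.
Proof.
move=> /asboolP[t [bt nt]].
have [[f [ft ef]]|ne] := pselect (skipped e t); last first.
  by apply/orP; left; apply/asboolP; exists t.
apply/orP; right; apply/asboolP; exists t; split=> // -[f' [f't e'f']].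
have ff' : f = f' by apply: code_inj; apply: succn_inj; rewrite ft f't.
by apply: nt; exists f; split=> //; rewrite leUx ef ff'.
Qed.

(** A block labelled by [e'] is skipped by [e'], which lies above itself, and used entirely by [e],
    since [e'] is not above [e]. *)
Lemma count_uses_separated e e' C : ~~ (e <= e')%O -> exists j,
  (C * (count_scales order_profile e' j).+2 < count_scales order_profile e j)%N.
Proof.
(* The power of 2 gives [t] the label of [e']; the odd factor makes t > 2C, so that C (t! + 1) <= 2C
   t! < t * t! absorbs the [.+2]. *)
move=> nee'; pose t := (2 ^ (code e').+1 * C.*2.*2.+1)%N.
have lt_t : label t = (code e').+1 by rewrite /t label_pow.
have t_big : (C.*2 < t)%N.
  apply: (@leq_trans C.*2.*2.+1); first by rewrite -!addnn; lia.
  by rewrite /t leq_pmull// expn_gt0.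
have t_gt0 : (0 < t`!)%N by exact: fact_gt0.
pose j := (t.+1`!).-1; exists j.
have tj : (t`!.-1 <= j)%N.
  by rewrite /j -!subn1 leq_sub2r// factS leq_pmull.
have in_block k : (t`!.-1 <= k < j)%N -> block t k.
  by rewrite /j /block => /andP[h1 h2]; apply/andP; split; lia.
have cnt e0 : count_scales order_profile e0 j =
    (\sum_(0 <= k < t`!.-1) uses e0 k + \sum_(t`!.-1 <= k < j) uses e0 k)%N.
  by rewrite /count_scales (big_cat_nat (n := t`!.-1)).
have low : (count_scales order_profile e' j <= t`!.-1)%N.
  have zero : (\sum_(t`!.-1 <= k < j) uses e' k = 0)%N.
    rewrite big_nat big1// => k kb.
    apply/eqP; rewrite eqb0; apply/negP => /asboolP[t' [bt' nt']].
    by apply: nt'; exists e'; rewrite (block_uniq bt' (in_block k kb)).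
  rewrite cnt zero addn0.
  apply: (@leq_trans (\sum_(0 <= k < t`!.-1) 1)); last by rewrite sum_nat_const_nat subn0 muln1.
  by apply: leq_sum => k _; exact: leq_b1.
have high : (t * t`! <= count_scales order_profile e j)%N.
  rewrite cnt; apply: (leq_trans _ (leq_addl _ _)).
  have -> : (\sum_(t`!.-1 <= k < j) uses e k = \sum_(t`!.-1 <= k < j) 1)%N.
    rewrite big_nat [RHS]big_nat; apply: eq_bigr => k kb.
    suff -> : uses e k by [].
    apply/asboolP; exists t; split; first exact: in_block.
    move=> [f []]; rewrite lt_t => /succn_inj/code_inj -> ee'.
    by rewrite ee' in nee'.
  by rewrite sum_nat_const_nat muln1 /j factS mulSn; lia.
apply: (leq_trans _ high).
apply: (@leq_ltn_trans (C * t`!.+1)); first by rewrite leq_mul2l; apply/orP; right; lia.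
apply: (@leq_ltn_trans (C.*2 * t`!)); first by rewrite -muln2 -mulnA leq_mul2l; lia.
by rewrite ltn_mul2r t_gt0.
Qed.

End Profile.

(** * Classification *)

Section Classification.
Context {R : realType} {d : Order.disp_t} {L : joinSemilatticeType d}.
Variables (code : L -> nat) (code_inj : injective code).
Notation gam := (order_profile code).
Notation X := (@lorentz R L gam).

Lemma dominates_unitE e e' :
  dominates (@unit_vec R L gam e') (@unit_vec R L gam e) <-> (e <= e')%O.
Proof.
split=> [/dominates_unit_count[C hC]|ee']; last first.
  by apply: dominates_unit_mono => k; exact: uses_mono.
apply: contraT => /(count_uses_separated code_inj C)[j].
by rewrite ltnNge hC.
Qed.

(** Otherwise all limits vanish, averages being decreasing in [k]; but a finite set of pairs
    eventually carries at least half of the unit norm, and finite sums commute with limits. *)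
Lemma some_lim_avg (x : nat -> X) (U : set_system nat) (UU : UltraFilter U) :
  \oo `<=` U -> weakly_null x -> normalized x -> exists e, 0 < lim_avg x U e 0.
Proof.
move=> ooU xw x1; apply: contrapT => none.
have lim0 e k : lim_avg x U e k <= 0.
  elim: k => [|k IH]; last exact: le_trans (lim_avg_decr x1 UU e k) IH.
  by rewrite leNgt; apply/negP => h; apply: none; exists e.
have half0 : 0 < 2^-1 :> R by rewrite invr_gt0.
have [F [N tail]] := weakly_null_tail xw half0.
pose F' := [seq p <- undup F | gam p.1 p.2].
have aF' : active gam F' by rewrite /active filter_all filter_uniq ?undup_uniq.
have big m : (N <= m)%N -> 2^-1 <= top_sum F' (x m).
  move=> Nm; have : `|x m| <= top_sum F' (x m) + 2^-1.
    apply: norm_le_top_sum => // G aG GF; apply: tail => // p pG.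
    apply: contra (GF p pG) => pF; rewrite mem_filter mem_undup pF andbT.
    by case/andP: aG => _ /allP/(_ _ pG).
  by rewrite x1; lra.
have h : top_sum F' (x m) @[m --> U] --> \sum_(p <- F') lim_avg x U p.1 p.2.
  by apply: cvg_big => [|p _]; [exact: add_continuous|exact: lim_avgP].
have : 2^-1 <= \sum_(p <- F') lim_avg x U p.1 p.2.
  by apply: (cvgr_to_ge h); apply: ooU; exists N.
have : \sum_(p <- F') lim_avg x U p.1 p.2 <= 0 by apply: sumr_le0 => p _.
by lra.
Qed.

Lemma spreading_model_classified (y : nbseq R) :
  ~ (exists u : nat -> L, forall n, (u n < u n.+1)%O) ->
  spreading_model_w X y -> exists g, equivalent (@unit_nbseq R L gam g) y.
Proof.
move=> noincr [x [x1 _ xw xy]].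
have [U [UU ooU]] := ultraFilterLemma (F := \oo) _.
have lower e : 0 < lim_avg x U e 0 -> dominates y (@unit_vec R L gam e).
  move=> e0; have e2 : 0 < lim_avg x U e 0 / 2 by rewrite divr_gt0.
  apply: (dominates_lower UU ooU xw xy e2).
  apply: (cvgr_ge _ (@lim_avgP _ _ _ _ x1 _ UU e 0%N)); lra.
have [e0 e0P] := some_lim_avg UU ooU xw x1.
have [g [yg gmax]] : exists g, dominates y (@unit_vec R L gam g) /\
    forall g', (g < g')%O -> ~ dominates y (@unit_vec R L gam g').
  apply: contrapT => nomax; apply: noincr.
  pose T := {g | dominates y (@unit_vec R L gam g)}.
  have step (g : T) : {g' : T | (sval g < sval g')%O}.
    case: g => g yg /=; apply: cid; apply: contrapT => ng; apply: nomax.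
    by exists g; split=> // g' gg' yg'; apply: ng; exists (exist _ g' yg').
  have [u [_ uP]] := dependent_choice step (exist _ e0 (lower e0 e0P)).
  by exists (fun n => sval (u n)).
exists g; split=> //; apply: (dominates_upper xw x1 UU ooU xy) => e eP k.
apply: uses_mono; have yge : dominates y (@unit_vec R L gam (g `|` e)%O).
  apply: dominates_unit_join yg (lower e eP) => i; exact: uses_join.
have : ~~ (g < g `|` e)%O by apply/negP => /gmax.
by rewrite lt_neqAle leUl andbT negbK => /eqP->; exact: leUr.
Qed.

End Classification.

Unset Implicit Arguments.

Theorem theorem15 (R : realType) (d : Order.disp_t) (L : joinSemilatticeType d)
    (Lcountable : countable [set: L])
    (Lnoincr : ~ exists u : nat -> L, forall n, (u n < u n.+1)%O) :
  exists (X : completeNormedModType R) (Theta : L -> SPw X),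
    bijective Theta /\
    (forall e1 e2 : L, (e1 <= e2)%O <-> SPw_le (Theta e1) (Theta e2)).
Proof.
have /countable_injP[code code_inj'] := Lcountable.
have code_inj : injective code by move=> e f; apply: code_inj'; rewrite inE.
pose gam := order_profile code; pose X := @lorentz R L gam.
pose cls e : SPw X := exist _ (eq_class (@unit_nbseq R L gam e))
  (ex_intro2 _ _ _ (@unit_spreading_model R L gam e) erefl).
have order e1 e2 : (e1 <= e2)%O <-> SPw_le (cls e1) (cls e2).
  rewrite (SPw_leP (x := unit_nbseq e1) (y := unit_nbseq e2))//.
  by rewrite (dominates_unitE code_inj).
exists X, cls; split=> //.
have clsP (A : SPw X) : {e | cls e = A}.
  apply: cid; case: A => A [y yX AE].
  have [g gy] := spreading_model_classified code_inj Lnoincr yX.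
  by exists g; apply: eq_exist; rewrite AE; apply/eq_class_equivalent.
have cls_inj e1 e2 : cls e1 = cls e2 -> e1 = e2.
  move=> E; apply/le_anti/andP; split; apply/order; rewrite E; apply/order; exact: lexx.
exists (fun A => sval (clsP A)) => [e|A]; last exact: svalP (clsP A).
by apply: cls_inj; exact: svalP (clsP (cls e)).
Qed.
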